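(* Let $(\mathcal{A},\phi)$ be a scalar probability space. An element $a\in\mathcal{A}$ is $R$-diagonal if and only if the following two conditions hold: (1) for every $z\in\mathbb{C}$ with $|z|=1$, the elements $a$ and $za$ have the same distribution; (2) $aa^\star$ and $\mathcal{K}_a$ are free.
   Context: A scalar probability space $(\mathcal{A},\phi)$ is a unital $\star$-algebra with a normal, tracial, faithful state $\phi$. Two elements have the same distribution if all their $\star$-moments $\phi(x^{s_1}\cdots x^{s_n})$, $s_i\in\{1,\star\}$, agree. Freeness: subsets $(X_s)_{s\in S}$ of $\mathcal{A}$ are free if, with $\mathcal{A}_s$ the unital algebra generated by $X_s$, $\phi(x_1\cdots x_n)=0$ whenever $n\ge1$, $x_j\in\mathcal{A}_{s_j}$, $\phi(x_j)=0$ for all $j$, and $s_j\neq s_{j+1}$ for all $j<n$. Cumulants: the scalar cumulants $\kappa$ are defined by $\phi(a_1\cdots a_n)=\sum_{\pi\in NC(\{1,\dots,n\})}\kappa_\pi(a_1\otimes\cdots\otimes a_n)$ (sum over noncrossing partitions), where $\kappa_\pi$ is the product over blocks $\{i_1<\dots<i_m\}$ of $\pi$ of $\kappa(a_{i_1}\otimes\cdots\otimes a_{i_m})$. $R$-diagonality: $a$ is $R$-diagonal if $\kappa(a^{s_1}\otimes\cdots\otimes a^{s_n})=0$ whenever $n\ge1$, $s_i\in\{1,\star\}$, and $(s_1,\dots,s_n)$ is not of the form $(1,\star,\dots,1,\star)$ or $(\star,1,\dots,\star,1)$. The algebra $\mathcal{K}_a$: write $a^{1}:=a$ and $a^{-1}:=a^\star$.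 A nonempty sequence $(s_1,\dots,s_n)$ with $s_i\in\{-1,1\}$ is balanced if $s_1+\cdots+s_n=0$ and all partial sums $s_1,\ s_1+s_2,\dots,s_1+\cdots+s_{n-1}$ are $\le0$. Then $\mathcal{K}_a=\operatorname{span}\{a^{s_1}a^{s_2}\cdots a^{s_n}:(s_1,\dots,s_n)\text{ is balanced}\}$. *)

(* Defs.v *)
From HB Require Import structures.
From mathcomp Require Import all_boot all_order all_algebra.

Set Implicit Arguments.
Unset Strict Implicit.
Unset Printing Implicit Defensive.

Import Order.TTheory GRing.Theory Num.Theory.
Local Open Scope ring_scope.

HB.mixin Record hasStar (C : numClosedFieldType) A of GRing.Algebra C A := {
  star : A -> A;
  starK : involutive star;
  starD : {morph star : x y / x + y};
  starZ : forall (c : C) (x : A), star (c *: x) = c^* *: star x;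
  starM : forall x y : A, star (x * y) = star y * star x
}.

#[short(type="starAlgType")]
HB.structure Definition StarAlgebra (C : numClosedFieldType) :=
  { A of GRing.Algebra C A & hasStar C A }.

(* A letter is a boolean: [false] stands for the exponent 1, and [true] for the
   exponent star, also written -1. *)
Definition star_pow (C : numClosedFieldType) (A : starAlgType C)
  (x : A) (b : bool) : A := if b then star x else x.

Definition word (C : numClosedFieldType) (A : starAlgType C)
  (x : A) (s : seq bool) : A := \prod_(b <- s) star_pow x b.

Definition same_distribution (C : numClosedFieldType) (A : starAlgType C)
  (phi : {scalar A}) (x y : A) : Prop :=
  forall s : seq bool, phi (word x s) = phi (word y s).

Definition noncrossing (n : nat) (P : {set {set 'I_n}}) : bool :=
  [forall B in P, forall B' in P,
    [exists i in B, exists j in B', exists k in B, exists l in B',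
      [&& (i < j)%N, (j < k)%N & (k < l)%N]] ==> (B == B')].

Definition NC (n : nat) : {set {set {set 'I_n}}} :=
  [set P | partition P [set: 'I_n] & noncrossing P].

(* [enum B], hence the image below, lists the block [B] increasingly. *)
Definition subword (A : nmodType) (a : seq A) (B : {set 'I_(size a)}) : seq A :=
  [seq nth 0 a i | i : 'I_(size a) in B].

Section Cumulants.
Variables (C : numClosedFieldType) (A : starAlgType C) (phi : {scalar A}).

(* [kappa [:: a_1; ...; a_n]] is the value of kappa on the tensor
   [a_1 (x) ... (x) a_n].  The moment-cumulant formula is solved for its
   one-block term; [m] is fuel.  See [moment_cumulant] and [cumulant_unique]. *)
Fixpoint cumulant_rec (m : nat) (a : seq A) : C :=
  if m is m'.+1 then
    phi (\prod_(x <- a) x) -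
    \sum_(P in NC (size a) | P != [set [set: 'I_(size a)]])
       \prod_(B in P) cumulant_rec m' (subword B)
  else 0.

Lemma cumulant_recS (m : nat) (a : seq A) :
  cumulant_rec m.+1 a =
  phi (\prod_(x <- a) x) -
  \sum_(P in NC (size a) | P != [set [set: 'I_(size a)]])
     \prod_(B in P) cumulant_rec m (subword B).
Proof. by []. Qed.

Definition cumulant (a : seq A) : C := cumulant_rec (size a) a.

Lemma size_subword (a : seq A) (B : {set 'I_(size a)}) :
  size (subword B) = #|B|.
Proof. by rewrite size_map -cardE. Qed.

Lemma subwordT (a : seq A) : subword [set: 'I_(size a)] = a.
Proof.
rewrite /subword /image_mem enum_setT -enumT.
rewrite (map_comp (nth 0 a) val) val_enum_ord.
exact: (mkseq_nth 0 a).
Qed.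

Lemma partition_block_lt (n : nat) (P : {set {set 'I_n}}) (B : {set 'I_n}) :
  partition P [set: 'I_n] -> P != [set [set: 'I_n]] -> B \in P ->
  (#|B| < n)%N.
Proof.
move=> /and3P[_ /trivIsetP tP P0] PT BP.
have : (#|B| <= n)%N by rewrite -[X in (_ <= X)%N]card_ord max_card.
rewrite leq_eqVlt => /orP[/eqP Bn|//].
have BT : B = [set: 'I_n].
  by apply/eqP; rewrite eqEcard subsetT cardsT card_ord Bn leqnn.
case/eqP: PT; apply/setP => D; rewrite inE.
apply/idP/eqP => [DP|->]; last by rewrite -BT.
have [->|DB] := eqVneq D B; first by [].
have := tP _ _ DP BP DB; rewrite BT -setI_eq0 setIT => /eqP D0.
by rewrite -D0 DP in P0.
Qed.

Lemma one_block_NC (n : nat) : [set [set: 'I_n.+1]] \in NC n.+1.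
Proof.
rewrite inE; apply/andP; split.
  apply/and3P; split.
  - by rewrite /cover big_set1.
  - by apply/trivIsetP => D E /set1P-> /set1P->; rewrite eqxx.
  - by apply/set1P => /setP/(_ ord0); rewrite !inE.
by apply/'forall_implyP => D /set1P->; apply/'forall_implyP => E /set1P->;
  rewrite eqxx implybT.
Qed.

Lemma cumulant_rec_fuel (m : nat) (a : seq A) :
  (size a <= m)%N -> a != [::] -> cumulant_rec m a = cumulant a.
Proof.
rewrite /cumulant; elim/ltn_ind: m a => -[|m] IH [|x a] // le_am _.
rewrite -[RHS]/(cumulant_rec (size a).+1 (x :: a)) !cumulant_recS.
congr (_ - _); apply: eq_bigr => P /andP[]; rewrite inE => /andP[pP _] PT.
apply: eq_bigr => B BP.
have := partition_block_lt pP PT BP; rewrite -size_subword /= ltnS => sB.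
have nB : subword (a := x :: a) B != [::].
  rewrite -size_eq0 size_subword cards_eq0.
  by apply: contraTneq BP => ->; case/and3P: pP.
rewrite ltnS in le_am.
rewrite (IH m)//; last exact: leq_trans le_am.
by apply/esym/(IH (size a)).
Qed.

Lemma moment_cumulant_solve (kappa : seq A -> C) (a : seq A) : a != [::] ->
  \sum_(P in NC (size a)) \prod_(B in P) kappa (subword B) =
  kappa a + \sum_(P in NC (size a) | P != [set [set: 'I_(size a)]])
              \prod_(B in P) kappa (subword B).
Proof.
move=> a0; rewrite (bigD1 [set [set: 'I_(size a)]]) /=; last first.
  by case: a a0 => // x a _; exact: one_block_NC.
by rewrite big_set1 subwordT.
Qed.

Lemma subword_neq0 (a : seq A) (P : {set {set 'I_(size a)}}) B :
  P \in NC (size a) -> B \in P -> subword B != [::].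
Proof.
rewrite inE => /andP[/and3P[_ _ P0] _] BP.
rewrite -size_eq0 size_subword cards_eq0.
by apply: contraTneq BP => ->.
Qed.

Lemma NC_block_lt (a : seq A) (P : {set {set 'I_(size a)}}) B :
  P \in NC (size a) -> P != [set [set: 'I_(size a)]] -> B \in P ->
  (size (subword B) < size a)%N.
Proof.
rewrite inE size_subword => /andP[pP _]; exact: partition_block_lt.
Qed.

Lemma moment_cumulant (a : seq A) : a != [::] ->
  phi (\prod_(x <- a) x) =
  \sum_(P in NC (size a)) \prod_(B in P) cumulant (subword B).
Proof.
move=> a0; rewrite moment_cumulant_solve//.
apply/eqP; rewrite -subr_eq; apply/eqP.
rewrite -(cumulant_rec_fuel (leqnSn (size a)) a0) cumulant_recS.
congr (_ - _); apply: eq_bigr => P /andP[PN PT]; apply: eq_bigr => B BP.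
by rewrite cumulant_rec_fuel ?(subword_neq0 PN)// ltnW// (NC_block_lt PN).
Qed.

Lemma cumulant_unique (kappa : seq A -> C) :
  (forall a : seq A, a != [::] ->
    phi (\prod_(x <- a) x) =
    \sum_(P in NC (size a)) \prod_(B in P) kappa (subword B)) ->
  forall a : seq A, a != [::] -> kappa a = cumulant a.
Proof.
move=> kE a; have [m] := ubnP (size a); elim: m a => // m IH a am a0.
have := kE a a0; rewrite moment_cumulant// !moment_cumulant_solve//.
rewrite [X in _ + X = _](_ : _ =
  \sum_(P in NC (size a) | P != [set [set: 'I_(size a)]])
    \prod_(B in P) kappa (subword B)); first by move=> /addIr.
apply: eq_bigr => P /andP[PN PT]; apply: eq_bigr => B BP.
apply/esym/IH; last exact: subword_neq0 PN BP.
exact: leq_trans (NC_block_lt PN PT BP) _.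
Qed.

End Cumulants.

Definition alternating (s : seq bool) : Prop :=
  exists k : nat, s = flatten (nseq k [:: false; true]) \/
                  s = flatten (nseq k [:: true; false]).

Definition R_diagonal (C : numClosedFieldType) (A : starAlgType C)
  (phi : {scalar A}) (a : A) : Prop :=
  forall s : seq bool, s != [::] -> ~ alternating s ->
    cumulant phi [seq star_pow a b | b <- s] = 0.

Definition exponent (b : bool) : int := if b then -1 else 1.

Definition balanced (s : seq bool) : Prop :=
  [/\ s != [::], \sum_(b <- s) exponent b = 0 &
      forall j, (0 < j < size s)%N -> \sum_(b <- take j s) exponent b <= 0].

From mathcomp Require Import boolp classical_sets reals.
Local Open Scope classical_set_scope.

Section StarOrder.
Variables (C : numClosedFieldType) (A : starAlgType C).

Definition selfadjoint (x : A) : Prop := star x = x.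

(* In a C*-algebra every sum of squares is a single square, so that [star_le]
   is the usual order there. *)
Definition star_nneg (x : A) : Prop :=
  exists s : seq A, x = \sum_(y <- s) star y * y.

Definition star_le (x y : A) : Prop := star_nneg (y - x).

Definition star_directed (D : set A) : Prop :=
  D !=set0 /\ forall x y, D x -> D y -> exists2 z, D z & star_le x z /\ star_le y z.

Definition star_lub (D : set A) (u : A) : Prop :=
  [/\ selfadjoint u, forall x, D x -> star_le x u &
      forall v, selfadjoint v -> (forall x, D x -> star_le x v) -> star_le u v].

End StarOrder.

Section State.
Variables (C : numClosedFieldType) (A : starAlgType C) (phi : {scalar A}).

Definition state : Prop := phi 1 = 1 /\ forall x : A, 0 <= phi (star x * x).

Definition tracial : Prop := forall x y : A, phi (x * y) = phi (y * x).

Definition faithful_state : Prop :=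
  forall x : A, phi (star x * x) = 0 -> x = 0.

(* Order continuity; on a von Neumann algebra these are exactly the normal
   states.  A state is real on self-adjoint elements, so, [D] being nonempty,
   every upper bound [c] of [phi @` D] in the partial order of [C] is real. *)
Definition normal_state : Prop :=
  forall (D : set A) (u : A),
    (forall x, D x -> selfadjoint x) -> star_directed D -> star_lub D u ->
    (forall x, D x -> phi x <= phi u) /\
    (forall c : C, (forall x, D x -> phi x <= c) -> phi u <= c).

Definition scalar_probability_space : Prop :=
  [/\ state, normal_state, tracial & faithful_state].

End State.

Definition generated_algebra (C : numClosedFieldType) (A : starAlgType C)
  (X : set A) : set A :=
  smallest [set B : set A | GRing.subalg_closed (mem B)] X.

Definition linear_span (C : numClosedFieldType) (A : starAlgType C)
  (X : set A) : set A :=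
  smallest [set V : set A | GRing.submod_closed (mem V)] X.

Definition free_family (C : numClosedFieldType) (A : starAlgType C)
  (phi : {scalar A}) (S : Type) (X : S -> set A) : Prop :=
  forall (n : nat) (s : nat -> S) (x : nat -> A), (0 < n)%N ->
    (forall j, (j < n)%N -> generated_algebra (X (s j)) (x j)) ->
    (forall j, (j < n)%N -> phi (x j) = 0) ->
    (forall j, (j.+1 < n)%N -> s j <> s j.+1) ->
    phi (\prod_(0 <= j < n) x j) = 0.

Definition free_pair (C : numClosedFieldType) (A : starAlgType C)
  (phi : {scalar A}) (X Y : set A) : Prop :=
  free_family phi (fun b : bool => if b then Y else X).

Definition K_alg (C : numClosedFieldType) (A : starAlgType C) (a : A) : set A :=
  linear_span [set word a s | s in [set s | balanced s]].

(* Main.v *)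
(* Write [mu s] for the moment of the word [s] in [a] and [star a].  The proof goes
   through a third condition: [mu] vanishes on the words with a nonzero sum of
   exponents, and phi((w_1 - mu w_1) ... (w_r - mu w_r)) = 0 whenever r >= 1, the
   [w_i] are nonempty alternating words and each [w_(i+1)] begins with the last
   letter of [w_i].
   - The condition determines [mu] from its values on alternating words.  It holds
     for the moments of any family of cumulants supported on alternating words of
     even length: in the first-block recursion, a block that leaves [w_1] for
     [w_2] across a gap with nonzero moment repeats a letter.  Comparing the
     cumulants of [a] with their restriction to such words shows that the
     condition is equivalent to R-diagonality.
   - A balanced word is, up to a scalar, a combination of such products beginning
     with [star a] and ending with [a], and (a star a)^k minus its moment is one
     beginning with [a] and ending with [star a].  Hence the condition gives
     freeness.
   - Conversely, view such a product as a closed path, [a] going up and [star a]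
     going down, and rotate it by traciality so that it starts at a highest
     breakpoint between factors.  The factors above that level are centered powers
     of a star a, the runs between them are centered elements of C + K_a, and
     freeness applies. *)
From HB Require Import structures.
Require Import Defs.
From mathcomp Require Import all_boot all_order all_algebra.
From mathcomp Require Import ring zify.

Set Implicit Arguments.
Unset Strict Implicit.
Unset Printing Implicit Defensive.

Import Order.TTheory GRing.Theory Num.Theory.
Local Open Scope ring_scope.

(** * Moments from free cumulants *)

Lemma rcons_neq0 (T : Type) (s : seq T) x : rcons s x <> [::].
Proof. by case: s. Qed.

Section Splits.
Variable T : Type.
Implicit Types (s t p q : seq T) (x : T).

(** Positions in a list are handled as decompositions [p ++ x :: q] instead of indices, so that the
    moment recursion follows the structure of the list. *)
Fixpoint splits (V : nmodType) (f : seq T -> T -> seq T -> V) s : V :=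
  if s is x :: s' then f [::] x s' + splits (fun p => f (x :: p)) s' else 0.

Lemma eq_splits (V : nmodType) (f g : seq T -> T -> seq T -> V) s :
  (forall p x q, s = p ++ x :: q -> f p x q = g p x q) ->
  splits f s = splits g s.
Proof.
elim: s f g => //= x s IH f g fg; congr (_ + _); first exact: fg.
by apply: IH => p y q sE; apply: fg; rewrite sE.
Qed.

Lemma splits_eq0 (V : nmodType) (f : seq T -> T -> seq T -> V) s :
  (forall p x q, s = p ++ x :: q -> f p x q = 0) -> splits f s = 0.
Proof.
elim: s f => //= x s IH f f0; rewrite (f0 [::]) // add0r; apply: IH => p y q sE.
by apply: f0; rewrite sE.
Qed.

Lemma splits_cat (V : nmodType) (f : seq T -> T -> seq T -> V) s t :
  splits f (s ++ t) =
  splits (fun p x q => f p x (q ++ t)) s + splits (fun p => f (s ++ p)) t.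
Proof. by elim: s f => [|x s IH] f /=; rewrite ?add0r // IH addrA. Qed.

Lemma splitsB (V : zmodType) (f g : seq T -> T -> seq T -> V) s :
  splits (fun p x q => f p x q - g p x q) s = splits f s - splits g s.
Proof.
elim: s f g => /= [|x s IH] f g; first by rewrite subr0.
by rewrite IH opprD addrACA.
Qed.

Lemma mulr_splits (R : pzSemiRingType) (c : R) f s :
  c * splits f s = splits (fun p x q => c * f p x q) s.
Proof. by elim: s f => /= [|x s IH] f; rewrite ?mulr0 // mulrDr IH. Qed.

Lemma sum_splits (V : nmodType) (f : T -> V) s :
  \sum_(x <- s) f x = splits (fun _ x _ => f x) s.
Proof. by elim: s => [|x s IH]; rewrite ?big_nil ?big_cons //= IH. Qed.

End Splits.

Section Moments.
Variables (R : comNzRingType) (T : Type).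
Implicit Types (k : seq T -> R) (u s t p q : seq T) (x : T).

(** The first letter opens the first block. The block function [f] is a parameter because this step
    occurs both inside the recursion that defines [open_mom] and after it. *)
Definition mom_of (f : seq T -> seq T -> R) s : R :=
  if s is x :: s' then f [:: x] s' else 1.

(* [open_mom k u s] is the sum over the noncrossing partitions of [u ++ s] for which
   the letters of [u] belong to one block; [n] is fuel. *)
Fixpoint open_rec k (n : nat) u s : R :=
  if n is n'.+1 then
    k u * mom_of (open_rec k n') s +
    splits (fun p x q => mom_of (open_rec k n') p * open_rec k n' (rcons u x) q) s
  else 0.

Definition open_mom k u s := open_rec k (size s).+1 u s.

Definition mom k s := mom_of (open_mom k) s.

Arguments open_mom : simpl never.
Arguments mom : simpl never.

Lemma open_rec_fuel k n u s :
  (size s < n)%N -> open_rec k n u s = open_mom k u s.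
Proof.
rewrite /open_mom; have [m] := ubnP (size s).
elim: m n u s => // m IH [//|n] u s; rewrite !ltnS => sm sn /=.
have momE t n1 : (size t <= m)%N -> (size t <= n1)%N ->
    mom_of (open_rec k n1) t = mom_of (fun u s => open_rec k (size s).+1 u s) t.
  by case: t => // x t tm tn; apply: IH.
congr (_ * _ + _); first by rewrite !momE.
apply: eq_splits => p x q sE; have := sm; have := sn.
rewrite sE size_cat /= => ? ?; rewrite !momE ?IH ?size_cat //=; lia.
Qed.

(** Either the open block is already complete, or it has a next letter [x]. In the second case no
    block may leave the gap [p] without crossing the open one, so [p] is partitioned by itself. *)
Lemma open_momE k u s : open_mom k u s =
  k u * mom k s + splits (fun p x q => mom k p * open_mom k (rcons u x) q) s.
Proof.
have momE n t : (size t <= n)%N -> mom_of (open_rec k n) t = mom k t.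
  by case: t => //= x t tn; rewrite open_rec_fuel.
rewrite {1}/open_mom /= momE //; congr (_ + _).
apply: eq_splits => p x q ->; rewrite size_cat /= momE ?open_rec_fuel //; lia.
Qed.

Lemma mom_nil k : mom k [::] = 1. Proof. by []. Qed.

Lemma mom_cons k x s : mom k (x :: s) = open_mom k [:: x] s. Proof. by []. Qed.

Lemma open_mom_lt k k' (n : nat) :
  (forall u, u <> [::] -> (size u < n)%N -> k u = k' u) ->
  forall u s, u <> [::] -> (size (u ++ s) < n)%N ->
  open_mom k u s = open_mom k' u s.
Proof.
move=> kk' u s; have [m] := ubnP (size s).
elim: m u s => // m IH u s; rewrite ltnS => sm u0 us.
have momE t : (size t <= m)%N -> (size t < n)%N -> mom k t = mom k' t.
  by case: t => // x t tm tn; rewrite !mom_cons IH.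
move: us; rewrite size_cat => us.
rewrite !open_momE kk' ?momE //; try lia; congr (_ + _).
apply: eq_splits => p x q sE; move: us sm.
rewrite sE size_cat /= => us sm; rewrite momE ?IH //; try lia.
- exact: rcons_neq0.
- rewrite size_cat size_rcons; lia.
Qed.

Lemma mom_lt k k' (n : nat) s :
  (forall u, u <> [::] -> (size u < n)%N -> k u = k' u) ->
  (size s < n)%N -> mom k s = mom k' s.
Proof. by case: s => // x s kk' sn; rewrite !mom_cons (open_mom_lt kk'). Qed.

Lemma mom_eq k k' s :
  (forall u, u <> [::] -> k u = k' u) -> mom k s = mom k' s.
Proof. by move=> kk'; apply: (mom_lt (n := (size s).+1)) => // u u0 _; apply: kk'. Qed.

(** Only the partition with a single block uses a cumulant of full length; all other terms agree and
    cancel. *)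
Lemma open_mom_sub k k' u s :
  (forall t, t <> [::] -> (size t < size (u ++ s))%N -> k t = k' t) ->
  u <> [::] -> open_mom k u s - open_mom k' u s = k (u ++ s) - k' (u ++ s).
Proof.
have [m] := ubnP (size s); elim: m u s => // m IH u [_|x s].
  by rewrite !open_momE /= cats0 !mulr1 !addr0.
rewrite /= ltnS => sm kk' u0.
have uxs : size (u ++ x :: s) = size (rcons u x ++ s) by rewrite cat_rcons.
rewrite !open_momE /= !mom_nil !mul1r.
have momE t : (size t <= size (x :: s))%N -> mom k t = mom k' t.
  move=> ts; apply: mom_lt kk' _; rewrite size_cat.
  by case: u u0 {uxs} => // ? ? _; move: ts => /=; lia.
rewrite (momE (x :: s)) // (kk' u) //; last by rewrite size_cat /=; lia.
(* A block that skips [x] leaves a nonempty gap, so these terms involve only words on which [k] and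
   [k'] agree. The term in which the block takes [x] is left for the induction. *)
set S := splits _ _; set S' := splits _ _.
have -> : S = S'.
  apply: eq_splits => p y q sE; rewrite momE; last by rewrite /= sE size_cat; lia.
  congr (_ * _); apply: open_mom_lt kk' _ _ _ _; first exact: rcons_neq0.
  by rewrite !size_cat size_rcons /= sE size_cat /=; lia.
rewrite opprD addrACA subrr add0r opprD addrACA subrr addr0 -cat_rcons IH //.
  by rewrite -uxs.
exact: rcons_neq0.
Qed.

Lemma mom_sub k k' s : s <> [::] ->
  (forall t, t <> [::] -> (size t < size s)%N -> k t = k' t) ->
  mom k s - mom k' s = k s - k' s.
Proof. by case: s => // x s _ kk'; rewrite !mom_cons open_mom_sub. Qed.

End Moments.

Arguments open_mom : simpl never.
Arguments mom : simpl never.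

Lemma mom_map (R : comNzRingType) (T T' : Type) (h : T' -> T) (k : seq T -> R) s :
  mom k (map h s) = mom (fun t => k (map h t)) s.
Proof.
have sm (V : nmodType) (f : seq T -> T -> seq T -> V) t :
    splits f (map h t) = splits (fun p x q => f (map h p) (h x) (map h q)) t.
  by elim: t f => //= x t IH f; rewrite IH.
suff open_map u t : open_mom k (map h u) (map h t) =
    open_mom (fun t => k (map h t)) u t.
  by case: s => // x s; rewrite /= !mom_cons (open_map [:: x]).
have [m] := ubnP (size t); elim: m u t => // m IH u t; rewrite ltnS => tm.
have mm s' : (size s' <= m)%N -> mom k (map h s') = mom (fun t => k (map h t)) s'.
  by case: s' => // x s' sm'; rewrite /= !mom_cons (IH [:: x]).
rewrite !open_momE mm // sm; congr (_ + _); apply: eq_splits => p x q tE.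
move: tm; rewrite tE size_cat /= => tm.
by rewrite mm -?map_rcons ?IH //; lia.
Qed.

(** * Centered products of alternating words *)

Definition height (s : seq bool) : int := \sum_(b <- s) exponent b.

Lemma height_cat s t : height (s ++ t) = height s + height t.
Proof. by rewrite /height big_cat. Qed.

Lemma height_nil : height [::] = 0. Proof. by rewrite /height big_nil. Qed.

Lemma height_cons b s : height (b :: s) = exponent b + height s.
Proof. by rewrite /height big_cons. Qed.

Lemma height_rcons s b : height (rcons s b) = height s + exponent b.
Proof. by rewrite -cats1 height_cat height_cons height_nil addr0. Qed.

Definition differ : rel bool := fun b c => b != c.

(** Neighbouring letters cancel in pairs, so only the parity of the length matters, and the last
    letter reveals it. *)
Lemma height_alternating b s : path differ b s ->
  height (b :: s) = if last b s == b then exponent b else 0.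
Proof.
elim: s b => [|c s IH] b; first by rewrite height_cons height_nil addr0 eqxx.
rewrite height_cons /= => /andP[bc /IH->].
by case: b c (last c s) bc => -[] [].
Qed.

(* [y] is the letter with which the first word has to begin. *)
Fixpoint chain (y : bool) (ws : seq (seq bool)) : bool :=
  match ws with
  | [::] => true
  | [::] :: _ => false
  | (x :: w) :: ws' => [&& x == y, path differ x w & chain (last x w) ws']
  end.

Lemma chain_cat y ws1 ws2 :
  chain y (ws1 ++ ws2) = chain y ws1 && chain (last y (flatten ws1)) ws2.
Proof.
elim: ws1 y => //= -[|x w] ws1 IH y //=.
by rewrite last_cat IH !andbA.
Qed.

Section Centered.
Variables (R : comNzRingType) (c : seq bool -> R).
Implicit Types (f : seq bool -> R) (u v w t : seq bool) (ws : seq (seq bool)).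

(* The value at u (w_1 - c w_1) ... (w_r - c w_r) v of the linear extension of [f]. *)
Fixpoint centered f u ws v : R :=
  if ws is w :: ws' then
    centered f (u ++ w) ws' v - c w * centered f u ws' v
  else f (u ++ v).

Lemma centered_rcons f u ws w v :
  centered f u (rcons ws w) v =
  centered f u ws (w ++ v) - c w * centered f u ws v.
Proof.
elim: ws u => [|w' ws IH] u /=; first by rewrite catA.
rewrite !IH; ring.
Qed.

Lemma centered_prefix f u t ws v :
  centered f (u ++ t) ws v = centered (fun s => f (u ++ s)) t ws v.
Proof.
by elim: ws t => [|w ws IH] t /=; rewrite -catA // !IH.
Qed.

Lemma eq_centered f g u ws v : f =1 g -> centered f u ws v = centered g u ws v.
Proof. by move=> fg; elim: ws u => [|w ws IH] u /=; rewrite ?fg ?IH. Qed.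

Lemma centered_eq0 f u ws v : (forall s, f s = 0) -> centered f u ws v = 0.
Proof. by move=> f0; elim: ws u => [|w ws IH] u /=; rewrite ?f0 // !IH mulr0 subr0. Qed.

Hypothesis c0 : forall w, height w != 0 -> c w = 0.

(** Replacing a factor [w] by the constant [c w] changes the height only if [c w] is zero, so every
    surviving term of the expansion has the height of the full word. *)
Lemma centered_height f : (forall s, height s != 0 -> f s = 0) ->
  forall u ws v, height (u ++ flatten ws ++ v) != 0 -> centered f u ws v = 0.
Proof.
move=> f0 u ws v; elim: ws u => [|w ws IH] u /=; first exact: f0.
rewrite !height_cat => h; rewrite IH ?sub0r ?height_cat; last by rewrite -!addrA in h *.
have [w0|/c0->] := eqVneq (height w) 0; last by rewrite mul0r oppr0.
rewrite IH ?mulr0 ?oppr0 // !height_cat.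
by move: h; rewrite w0 add0r.
Qed.

End Centered.

Lemma eq_centered_lt (R : comNzRingType) (f f' : seq bool -> R) (n : nat) u ws v :
  (forall s, (size s < n)%N -> f s = f' s) ->
  (size (u ++ flatten ws ++ v) < n)%N ->
  centered f f u ws v = centered f' f' u ws v.
Proof.
move=> ff'; elim: ws u => [|w ws IH] u /=; first exact: ff'.
rewrite !size_cat => sn; rewrite ff'; last by lia.
by rewrite !IH // !size_cat; lia.
Qed.

(** As the factors are nonempty, every term of the expansion except the full word is shorter. This
    is how the vanishing of centered products determines a moment from shorter ones. *)
Lemma centered_sub (R : comNzRingType) (f f' : seq bool -> R) (n : nat) u ws v :
  (forall s, (size s < n)%N -> f s = f' s) ->
  all (fun w => 0 < size w < n)%N ws ->
  (size (u ++ flatten ws ++ v) <= n)%N ->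
  centered f f u ws v - centered f' f' u ws v =
  f (u ++ flatten ws ++ v) - f' (u ++ flatten ws ++ v).
Proof.
move=> ff'; elim: ws u => //= w ws IH u /andP[/andP[w0 wn] wsn].
rewrite !size_cat => sn.
rewrite (ff' w) // (eq_centered_lt (u := u) ff'); last by rewrite !size_cat; lia.
rewrite -[(w ++ _) ++ _]catA catA -(IH (u ++ w)) //; last by rewrite !size_cat; lia.
ring.
Qed.

Definition RdiagMoments (R : comNzRingType) (m : seq bool -> R) : Prop :=
  [/\ m [::] = 1, forall s, height s != 0 -> m s = 0 &
  forall y ws, chain y ws -> ws != [::] -> centered m m [::] ws [::] = 0].

(** * Centered products vanish for cumulants supported on alternating words *)

Section RdiagCumulants.
Variables (R : comNzRingType) (k : seq bool -> R).
Hypothesis k_alt : forall u, ~~ sorted differ u -> k u = 0.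
Hypothesis k_height : forall u, height u != 0 -> k u = 0.

Notation m := (mom k).
Notation G := (open_mom k).

(** A repeated letter in the open block survives every extension of that block. *)
Lemma open_mom_alt u s : ~~ sorted differ u -> G u s = 0.
Proof.
have [n] := ubnP (size s); elim: n u s => // n IH u s; rewrite ltnS => sn nu.
rewrite open_momE k_alt // mul0r add0r; apply: splits_eq0 => p x q sE.
rewrite IH ?mulr0 //; first by move: sn; rewrite sE size_cat /=; lia.
by apply: contra nu; rewrite -cats1 => /cat_sorted2[].
Qed.

Lemma open_mom_height u s : height (u ++ s) != 0 -> G u s = 0.
Proof.
have [n] := ubnP (size s); elim: n u s => // n IH u s; rewrite ltnS => sn nu.
have m0 t : (size t <= n)%N -> height t != 0 -> m t = 0.
  case: t => [|x t] tn t0; first by rewrite height_nil eqxx in t0.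
  by rewrite mom_cons IH.
rewrite open_momE splits_eq0 => [|p x q sE].
  have [u0|/k_height->] := eqVneq (height u) 0; last by rewrite mul0r addr0.
  by rewrite m0 ?mulr0 ?addr0 //; move: nu; rewrite height_cat u0 add0r.
move: sn nu; rewrite sE size_cat /= => sn.
have [p0|/m0->] := eqVneq (height p) 0; [|by rewrite mul0r|lia].
rewrite !height_cat p0 add0r => h.
by rewrite IH ?mulr0 ?cat_rcons ?height_cat //; lia.
Qed.

Lemma mom_height s : height s != 0 -> m s = 0.
Proof.
case: s => [|x s]; first by rewrite height_nil eqxx.
by rewrite mom_cons => h; apply: open_mom_height.
Qed.

(** The first-block recursion for a centered product: the block ends, or its next letter lies in [t]
    or in a factor [w]. In the last case the factors before [w] fall into the gap and stay centered
    there, those after [w] stay centered outside, and the constant subtracted from [w] offers no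
    letter. *)
Lemma centered_open u t ws : centered m (G u) t ws [::] =
  k u * centered m m t ws [::] +
  splits (fun p x q => m p * centered m (G (rcons u x)) q ws [::]) t +
  splits (fun ws1 w ws2 => splits (fun p x q =>
    centered m m t ws1 p * centered m (G (rcons u x)) q ws2 [::]) w) ws.
Proof.
elim: ws t => [|w ws IH] t /=.
  rewrite !cats0 addr0 open_momE; congr (_ + _).
  by apply: eq_splits => p x q _; rewrite cats0.
rewrite !IH splits_cat.
have -> : splits (fun p x q => m p * (centered m (G (rcons u x)) (q ++ w) ws [::]
     - m w * centered m (G (rcons u x)) q ws [::])) t =
   splits (fun p x q => m p * centered m (G (rcons u x)) (q ++ w) ws [::]) t -
   m w * splits (fun p x q => m p * centered m (G (rcons u x)) q ws [::]) t.
  rewrite mulr_splits -splitsB; apply: eq_splits => p x q _; ring.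
have -> : splits (fun p w0 ws2 => splits (fun p0 x q =>
      (centered m m (t ++ w) p p0 - m w * centered m m t p p0) *
      centered m (G (rcons u x)) q ws2 [::]) w0) ws =
   splits (fun p w0 ws2 => splits (fun p0 x q =>
      centered m m (t ++ w) p p0 * centered m (G (rcons u x)) q ws2 [::]) w0) ws -
   m w * splits (fun p w0 ws2 => splits (fun p0 x q =>
      centered m m t p p0 * centered m (G (rcons u x)) q ws2 [::]) w0) ws.
  rewrite mulr_splits -splitsB; apply: eq_splits => p x q _.
  rewrite mulr_splits -splitsB; apply: eq_splits => p' x' q' _; ring.
ring.
Qed.

Lemma mom_Rdiag : RdiagMoments m.
Proof.
split=> // [|y ws]; first exact: mom_height.
have [n] := ubnP (size (flatten ws)); elim: n y ws => // n IH y ws; rewrite ltnS.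
(* A gap that contains a complete factor has moment 0: writing its uncentered ends [t] and [v] as
   centered words plus constants leaves shorter centered products, which vanish by induction. *)
have aux x t ws' v : path differ x t -> chain (last x t) (rcons ws' v) ||
    (v == [::]) && chain (last x t) ws' ->
    ws' != [::] -> (size (t ++ flatten ws' ++ v) < n)%N ->
    centered m m t ws' v = 0.
  move=> xt ch ws0 sn.
  have ch' : chain (last x t) ws'.
    by move: ch; rewrite -cats1 chain_cat; case/orP => /andP[].
  have t0 ws1 : chain (last x t) ws1 -> ws1 != [::] ->
      (size (t ++ flatten ws1) < n)%N -> centered m m t ws1 [::] = 0.
    move=> ch1 ws10 sn1.
    rewrite size_cat in sn1.
    have e : centered m m [::] ws1 [::] = 0 by apply: IH ch1 ws10; lia.
    have [->//|tn] := eqVneq t [::].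
    case: t tn xt ch1 sn1 {ch ch' sn} => // z t _ /= /andP[_ zt] ch1 sn1.
    have := IH z ((z :: t) :: ws1); rewrite /= eqxx zt ch1 e ?mulr0 ?subr0.
    by apply; rewrite // size_cat; lia.
  have [v0|vn] := eqVneq v [::].
    by rewrite v0; apply: t0; rewrite // v0 cats0 in sn.
  move: ch; rewrite (negPf vn) orbF => ch.
  have := t0 (rcons ws' v); rewrite centered_rcons cats0 t0 //.
    rewrite mulr0 subr0; apply=> //; first by case: (ws').
    by rewrite flatten_rcons.
  by move: sn; rewrite !size_cat; lia.
case: ws =>  // -[//|z w] ws sn /= /and3P[_ zw ch] _.
case: ws sn ch => [|w' ws] sn ch; first by rewrite /= !cats0 mulr1 subrr.
set W := w' :: ws in sn ch *.
have W0 : W != [::] by [].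
clearbody W; move: W W0 sn ch => {w' ws} ws ws0 sn ch.
rewrite /= size_cat in sn.
(* The constant subtracted from the first factor multiplies a shorter centered product. What remains
   has the first factor uncentered, and its first letter [z] opens the block. *)
rewrite (IH (last z w)) //; last by lia.
rewrite mulr0 subr0 -[z :: w]cat1s centered_prefix.
rewrite (@eq_centered _ _ _ (G [:: z])) //.
have {zw ch sn} : [/\ path differ z w, chain (last z w) ws &
  (size w + size (flatten ws) < n)%N] by split => //; lia.
(* Here [x] is the latest letter of the block and [t] the rest of its factor. The induction on the
   length of [t] absorbs blocks that continue inside the same factor. *)
have claim d t x u : (size t < d)%N -> path differ x t ->
    chain (last x t) ws -> (size t + size (flatten ws) < n)%N ->
    centered m (G (rcons u x)) t ws [::] = 0.
  elim: d t x u => // d IHd t x u; rewrite ltnS => td xt ch sn.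
  rewrite centered_open (aux x) ?ch ?orbT ?cats0 ?size_cat // mulr0 add0r.
  rewrite splits_eq0 => [|p y' q tE]; last first.
    move: xt ch td sn; rewrite tE cat_path last_cat size_cat /= => /and3P[_ _ yq].
    by move=> ch td sn; rewrite IHd ?mulr0 //; lia.
  rewrite add0r; apply: splits_eq0 => ws1 v ws2 wsE; apply: splits_eq0 => p y' q vE.
  move: ch; rewrite wsE chain_cat vE => /andP[ch1 ch2].
  have szE : size (flatten ws) =
      (size (flatten ws1) + (size p + (size q).+1 + size (flatten ws2)))%N.
    by rewrite wsE flatten_cat /= vE !size_cat.
  have chp : chain (last (last x t) (flatten ws1)) [:: p] || (p == [::]).
    case: (p) ch2 => [|z' p'] //=.
    by rewrite cat_path andbT orbF => /and3P[-> /andP[->]].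
  (* If the block jumps over a complete factor, [aux] applies to the gap. Otherwise the gap is [t]
     followed by the beginning [p] of the next factor. *)
  have [ws10|ws10] := eqVneq ws1 [::]; last first.
    rewrite (aux x) ?mul0r //; last by rewrite !size_cat; lia.
    by rewrite -cats1 chain_cat ch1 /= andbT.
  rewrite {}ws10 /= in ch2 chp szE *.
  have [->|yx] := eqVneq y' x.
    rewrite [X in _ * X]centered_eq0 ?mulr0 // => s; apply: open_mom_alt.
    by rewrite -!cats1 -catA; apply/negP => /cat_sorted2[_]; rewrite /= /differ eqxx.
  (* If both parts of the gap have height 0, then the block repeats the letter [x]. *)
  have -> : m (t ++ p) = m t * m p.
    have [->|p0] := eqVneq p [::]; first by rewrite cats0 mulr1.
    (* With [p] as the only centered factor, [aux] says that the moment of [t ++ p] factors. *)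
    have := aux x t [:: p] [::] xt; rewrite (negPf p0) orbF in chp.
    rewrite /= !cats0 => /(_ _ isT); rewrite chp orbT size_cat mulrC => /(_ isT) e.
    by apply/eqP; rewrite -subr_eq0 e //; lia.
  have [t0|/mom_height->] := eqVneq (height t) 0; last by rewrite !mul0r.
  have [p0|/mom_height->] := eqVneq (height p) 0; last by rewrite mulr0 mul0r.
  have xE : last x t = x.
    have := height_alternating xt; rewrite height_cons t0 addr0.
    by case: eqP => // _; case: (x).
  move: ch2; rewrite xE; case: p p0 {szE chp vE} => [|z' p'] p0 /=.
    by rewrite (negPf yx).
  rewrite cat_path => /and3P[/eqP zx /andP[zp /andP[+ _]] _].
  have := height_alternating zp; rewrite p0 zx.
  by case: (x) y' (last _ p') yx => [] [] [].
by case=> zw ch sn; apply: (claim _ w z [::] (ltnSn _)).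
Qed.

End RdiagCumulants.

(** * Sums over noncrossing partitions *)

Section NoncrossingSums.
Variables (R : comNzRingType) (n : nat).
Implicit Types (P Q : {set {set 'I_n}}) (B D E : {set 'I_n}) (i j l : 'I_n).
Implicit Types (w : {set 'I_n} -> R).

(** The ground set is an arbitrary subset of ['I_n], so that removing elements and splitting stay
    within one type. *)
Definition nc_partition D P := partition P D && noncrossing P.

Definition ncsum D w : R := \sum_(P | nc_partition D P) \prod_(B in P) w B.

Lemma nc_partitionP D P : reflect
  [/\ forall B, B \in P -> B \subset D /\ exists x, x \in B,
      forall x, x \in D -> exists2 B, B \in P & x \in B,
      forall B B' x, B \in P -> B' \in P -> x \in B -> x \in B' -> B = B' &
      forall B B' x1 x2 x3 x4, B \in P -> B' \in P ->
        x1 \in B -> x2 \in B' -> x3 \in B -> x4 \in B' ->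
        (x1 < x2)%N -> (x2 < x3)%N -> (x3 < x4)%N -> B = B']
  (nc_partition D P).
Proof.
apply: (iffP andP) => [[/and3P[/eqP cD tP P0] nP]|[bD cD iP nP]]; split.
- move=> B BP; split; first by rewrite -cD; apply: bigcup_sup.
  by apply/set0Pn; apply: contraTneq BP => ->.
- by move=> x; rewrite -cD => /bigcupP[B BP xB]; exists B.
- by move=> B B' x BP B'P xB xB'; rewrite -(def_pblock tP BP xB) (def_pblock tP B'P xB').
- move=> B B' x1 x2 x3 x4 BP B'P b1 b2 b3 b4 l1 l2 l3.
  have /forallP/(_ B)/implyP/(_ BP)/forallP/(_ B')/implyP/(_ B'P) := nP.
  move/implyP => h; apply/eqP/h; apply/existsP; exists x1; rewrite b1.
  apply/existsP; exists x2.
  by rewrite b2; apply/existsP; exists x3; rewrite b3; apply/existsP; exists x4; apply/and4P.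
- apply/and3P; split.
  + apply/eqP/setP => x; apply/bigcupP/idP => [[B /bD[BD _]]|/cD[B]].
      exact: (subsetP BD).
    by exists B.
  + apply/trivIsetP => B B' BP B'P /eqP BB'; apply/pred0P => x /=.
    by apply/negP => /andP[xB xB']; apply: BB'; apply: iP xB'.
  + by apply/negP => /bD[_ [x]]; rewrite inE.
- apply/forallP => B; apply/implyP => BP; apply/forallP => B'; apply/implyP => B'P.
  apply/implyP => /existsP[x1 /andP[b1 /existsP[x2 /andP[b2 /existsP[x3]]]]].
  move=> /andP[b3 /existsP[x4 /andP[b4 /and3P[l1 l2 l3]]]].
  by apply/eqP; apply: nP l1 l2 l3.
Qed.

Lemma ncsum0 w : ncsum set0 w = 1.
Proof.
rewrite /ncsum (big_pred1 set0) ?big_set0 // => P /=.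
apply/nc_partitionP/eqP => [[bD _ _ _]|->].
  apply/setP => B; rewrite [RHS]inE; apply/negP => /bD[/subsetP BD [x /BD]].
  by rewrite inE.
by split=> [B|x|B B' x|B B' x1 x2 x3 x4]; rewrite inE.
Qed.

Lemma ncsum1 i w : ncsum [set i] w = w [set i].
Proof.
rewrite /ncsum (big_pred1 [set [set i]]) ?big_set1 // => P /=.
apply/nc_partitionP/eqP => [[bD cD _ _]|->].
  have Bi B : B \in P -> B = [set i].
    move=> /bD[BD [x xB]]; apply/setP => y; rewrite inE; apply/idP/eqP.
      by move/(subsetP BD)/set1P.
    by move->; move/(subsetP BD)/set1P: (xB) => <-.
  apply/setP => B; rewrite !inE; apply/idP/eqP; first exact: Bi.
  by move->; have [|B' B'P _] := cD i; rewrite ?inE // -(Bi _ B'P).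
split=> [B|x|B B' x|B B' x1 x2 x3 x4].
- by rewrite inE => /eqP->; split=> //; exists i; rewrite inE.
- by rewrite inE => /eqP->; exists [set i]; rewrite inE.
- by rewrite !inE => /eqP-> /eqP->.
- by rewrite !inE => /eqP-> /eqP->.
Qed.

Lemma eq_ncsum D w w' : (forall B, B \subset D -> w B = w' B) ->
  ncsum D w = ncsum D w'.
Proof.
move=> ww'; apply: eq_bigr => P /nc_partitionP[bD _ _ _].
by apply: eq_bigr => B /bD[BD _]; apply: ww'.
Qed.

Definition splitting D E P := [forall B in P, (B \subset D) || (B \subset E)].

Lemma nc_partition_sub D E P : nc_partition E P -> D \subset E ->
  (forall B x, B \in P -> x \in B -> x \in D -> B \subset D) ->
  nc_partition D (P ::&: D).
Proof.
move=> /nc_partitionP[bP cP iP nP] /subsetP DE hD; apply/nc_partitionP; split.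
- by move=> B; rewrite inE => /andP[/bP[_ ?] ?].
- by move=> x xD; have [B BP xB] := cP _ (DE _ xD); exists B; rewrite // inE BP (hD B x).
- by move=> B B' x; rewrite !inE => /andP[BP _] /andP[B'P _]; apply: iP.
- by move=> B B' x1 x2 x3 x4; rewrite !inE => /andP[BP _] /andP[B'P _]; apply: nP.
Qed.

(** Since [D] lies entirely before [E], a block on one side never crosses a block on the other.
    Union and restriction are then inverse bijections, and the product of weights factors. *)
Lemma ncsum_split D E w : (forall x y, x \in D -> y \in E -> (x < y)%N) ->
  \sum_(P | nc_partition (D :|: E) P && splitting D E P) \prod_(B in P) w B =
  ncsum D w * ncsum E w.
Proof.
move=> DE; rewrite /ncsum big_distrlr pair_big /=.
have xDE x : x \in D -> x \in E -> False by move=> xD xE; have := DE x x xD xE; rewrite ltnn.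
have nsub P Q B : nc_partition D P -> nc_partition E Q -> B \in P -> B \in Q -> False.
  move=> /nc_partitionP[bP _ _ _] /nc_partitionP[bQ _ _ _].
  by move=> /bP[/subsetP BD [x /[dup]/BD xD xB]] /bQ[/subsetP BE _]; apply: (xDE x); auto.
rewrite (reindex_onto (fun Q : {set {set 'I_n}} * {set {set 'I_n}} => Q.1 :|: Q.2)
  (fun P => (P ::&: D, P ::&: E))) /=; last first.
  move=> P /andP[_ /forallP sP]; apply/setP => B; rewrite !inE -andb_orr.
  by have := sP B; case: (B \in P).
have sIP P Q B : nc_partition D P -> nc_partition E Q -> B \in P :|: Q ->
    ((B \in P) = (B \subset D)) * ((B \in Q) = (B \subset E)).
  move=> PD QE; have /nc_partitionP[bP _ _ _] := PD.
  have /nc_partitionP[bQ _ _ _] := QE; rewrite inE => BPQ.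
  split; (apply/idP/idP; first by move=> BX; first [case: (bP _ BX)|case: (bQ _ BX)]) => BD.
    have [//|/= BP] := boolP (B \in P); rewrite (negPf BP) /= in BPQ.
    have [/subsetP BE [x xB]] := bQ _ BPQ.
    by case: (xDE x (subsetP BD x xB) (BE x xB)).
  have [//|/= BQ] := boolP (B \in Q); rewrite (negPf BQ) orbF /= in BPQ.
  have [/subsetP BP [x xB]] := bP _ BPQ.
  by case: (xDE x (BP x xB) (subsetP BD x xB)).
have prodU P Q : nc_partition D P -> nc_partition E Q ->
    \prod_(B in P :|: Q) w B = \prod_(B in P) w B * \prod_(B in Q) w B.
  move=> PD QE; rewrite -bigU /=; first by apply: eq_bigl => B; rewrite !inE.
  by apply/pred0P => B /=; apply/negP => /andP[]; apply: nsub.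
under [RHS]eq_bigr => Q /andP[QD QE] do rewrite -prodU //.
apply: eq_bigl => -[P Q] /=; apply/idP/idP.
  case/andP=> /andP[PQ /forallP sP] /eqP[PE QE].
  have s' B x : B \in P :|: Q -> x \in B ->
      (x \in D -> B \subset D) * (x \in E -> B \subset E).
    move=> BPQ xB; have := sP B; rewrite BPQ /=.
    move=> /orP[]/[dup]B' /subsetP/(_ x xB) x'; split=> // x''; by case: (xDE x).
  have := nc_partition_sub PQ (subsetUl D E); rewrite PE => -> => [|B x BP /(s' B x BP)[] //].
  have := nc_partition_sub PQ (subsetUr D E); rewrite QE => -> // B x BP.
  by case/(s' B x BP).
case/andP=> PD QE; rewrite -andbA.
have sI B := sIP P Q B PD QE.
have /nc_partitionP[bP cP iP nP] := PD; have /nc_partitionP[bQ cQ iQ nQ] := QE.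
apply/and3P; split.
- apply/nc_partitionP; split.
  + move=> B /setUP[/bP|/bQ] [BD ?]; split=> //; apply: subset_trans BD _;
      by rewrite ?subsetUl ?subsetUr.
  + by move=> x /setUP[/cP|/cQ] [B BP xB]; exists B; rewrite // inE BP ?orbT.
  + move=> B B' x /setUP[]BP /setUP[]B'P xB xB'; first exact: iP xB xB'.
    * have xD := subsetP (bP _ BP).1 x xB; have xE := subsetP (bQ _ B'P).1 x xB'.
      by case: (xDE x).
    * have xE := subsetP (bQ _ BP).1 x xB; have xD := subsetP (bP _ B'P).1 x xB'.
      by case: (xDE x).
    * exact: iQ xB xB'.
  + move=> B B' x1 x2 x3 x4 /setUP[]BP /setUP[]B'P b1 b2 b3 b4 l1 l2 l3.
    * exact: nP l1 l2 l3.
    * have xD := subsetP (bP _ BP).1 _ b3; have xE := subsetP (bQ _ B'P).1 _ b2.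
      by have := ltn_trans l2 (DE _ _ xD xE); rewrite ltnn.
    * have xE := subsetP (bQ _ BP).1 _ b1; have xD := subsetP (bP _ B'P).1 _ b2.
      by have := ltn_trans l1 (DE _ _ xD xE); rewrite ltnn.
    * exact: nQ l1 l2 l3.
- apply/forallP => B; apply/implyP => /setUP[/bP|/bQ] [-> _]; by rewrite ?orbT.
- rewrite xpair_eqE; apply/andP; split; apply/eqP/setP => B; rewrite !inE.
  + have [BP|BP] := boolP (B \in P); first by rewrite (bP _ BP).1.
    apply/negP => /andP[/= BQ].
    by have := sI B; rewrite inE BQ orbT => /(_ isT)[<- _]; apply/negP.
  + have [BQ|BQ] := boolP (B \in Q); first by rewrite orbT (bQ _ BQ).1.
    rewrite orbF; apply/negP => /andP[BP].
    by have := sI B; rewrite inE BP => /(_ isT)[_ <-]; apply/negP.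
Qed.

Section FirstElement.
Variables (i : 'I_n) (E : {set 'I_n}).
Hypothesis iE : forall x, x \in E -> (i < x)%N.

Let iNE : i \notin E.
Proof. by apply/negP => /iE; rewrite ltnn. Qed.

Let Ex x : x \in i |: E -> x != i -> x \in E.
Proof. by rewrite !inE => /predU1P[->|//]; rewrite eqxx. Qed.

(** For [j] in [E] this makes [j] the second element of the block of [i], the counterpart of the
    next letter in [open_momE]. *)
Definition next_in_block P j :=
  [exists B in P, [&& i \in B, j \in B & [forall l in B, (l == i) || (j <= l)%N]]].

(** Inverse to deleting [i] from the blocks, when [i] and [j] share a block. *)
Definition attach j B := if j \in B then i |: B else B.

Let below j := [set l in E | (l < j)%N].
Let above j := [set l in E | (j <= l)%N].

Let below_above j : below j :|: above j = E.
Proof. by apply/setP => x; rewrite !inE -andb_orr ltnNge orNb andbT. Qed.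

Lemma nc_attach j P : j \in E ->
  nc_partition E P && splitting (below j) (above j) P ->
  [/\ nc_partition (i |: E) [set attach j B | B in P],
      next_in_block [set attach j B | B in P] j &
      [set B :\ i | B in [set attach j B | B in P]] = P].
Proof.
move=> jE /andP[/nc_partitionP[bP cP iP nP] /forallP sP].
have iB B : B \in P -> i \notin B.
  by move=> /bP[/subsetP BE _]; apply: contra iNE; apply: BE.
have attE B x : B \in P -> (x \in attach j B) = (x \in B) || (x == i) && (j \in B).
  move=> BP; rewrite /attach; case: ifP => jB; last by rewrite andbF orbF.
  by rewrite !inE andbT orbC.
have [Bj BjP jBj] := cP _ jE.
have jabove B x : B \in P -> j \in B -> x \in B -> (j <= x)%N.
  move=> BP jB xB; have := sP B; rewrite BP /= => /orP[]/subsetP sB.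
    by have := sB _ jB; rewrite inE ltnn andbF.
  by have := sB _ xB; rewrite inE => /andP[].
split.
- apply/nc_partitionP; split.
  + move=> _ /imsetP[B BP ->]; have [/subsetP BE [x xB]] := bP _ BP; split.
      apply/subsetP => y; rewrite attE // => /orP[/BE|/andP[/eqP-> _]].
        by rewrite !inE => ->; rewrite orbT.
      by rewrite !inE eqxx.
    by exists x; rewrite attE // xB.
  + move=> x; rewrite !inE => /predU1P[->|/cP[B BP xB]].
      exists (attach j Bj); first exact: imset_f.
      by rewrite attE // eqxx jBj orbT.
    by exists (attach j B); [exact: imset_f|rewrite attE // xB].
  + move=> _ _ x /imsetP[B BP ->] /imsetP[B' B'P ->].
    rewrite !attE // => /orP[xB|/andP[/eqP xi jB]] /orP[xB'|/andP[/eqP xi' jB']].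
    * by rewrite (iP B B' x).
    * by move: (iB _ BP); rewrite -xi' xB.
    * by move: (iB _ B'P); rewrite -xi xB'.
    * by rewrite (iP B B' j).
  + move=> _ _ x1 x2 x3 x4 /imsetP[B BP ->] /imsetP[B' B'P ->].
    have gti (x y : 'I_n) B0 : B0 \in P -> (x < y)%N -> x \in i |: E ->
        y \in attach j B0 -> y \in B0.
      move=> B0P xy xE; rewrite attE // => /orP[//|/andP[/eqP yi _]].
      move: xE xy; rewrite yi !inE => /predU1P[->|/iE]; first by rewrite ltnn.
      by move=> h1 /(ltn_trans h1); rewrite ltnn.
    have inE' (x : 'I_n) B0 : B0 \in P -> x \in attach j B0 -> x \in i |: E.
      move=> B0P; rewrite attE // !inE => /orP[xB|/andP[/eqP-> _]]; last by rewrite eqxx.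
      by rewrite (subsetP (bP _ B0P).1 _ xB) orbT.
    move=> b1 b2 b3 b4 l1 l2 l3.
    have {}b4 := gti _ _ _ B'P l3 (inE' _ _ BP b3) b4.
    have {}b3 := gti _ _ _ BP l2 (inE' _ _ B'P b2) b3.
    have {}b2 := gti _ _ _ B'P l1 (inE' _ _ BP b1) b2.
    move: b1; rewrite attE // => /orP[b1|/andP[/eqP x1i jB]].
      by rewrite (nP B B' x1 x2 x3 x4).
    (* A crossing that uses [i] itself: if [j < x2], then [j] can take the place of [i]; if
       [x2 < j], then [B'] has elements on both sides of [j], against the splitting; if they are
       equal, the blocks meet. *)
    have [jx2|x2j|x2j] := ltngtP j x2.
    * by rewrite (nP B B' j x2 x3 x4).
    * have := sP B'; rewrite B'P /= => /orP[]/subsetP sB.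
        have := sB _ b4; have := jabove _ _ BP jB b3; rewrite !inE => h /andP[_ h'].
        by have := leq_ltn_trans h (ltn_trans l3 h'); rewrite ltnn.
      by have := sB _ b2; rewrite inE leqNgt x2j andbF.
    * by rewrite (iP B B' j) //; have -> : j = x2 by apply: val_inj.
- apply/existsP; exists (attach j Bj); rewrite imset_f //= !attE // eqxx jBj orbT /=.
  apply/forallP => l; apply/implyP; rewrite attE // => /orP[lB|/andP[-> //]].
  by rewrite (jabove Bj) ?orbT.
- rewrite -imset_comp -[RHS]imset_id; apply: eq_in_imset => B BP /=.
  apply/setP => x; rewrite !inE attE //; have [->|] := eqVneq x i; last by rewrite orbF.
  by rewrite (negPf (iB _ BP)).
Qed.

Lemma nc_detach j P : j \in E ->
  nc_partition (i |: E) P && next_in_block P j ->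
  [/\ nc_partition E [set B :\ i | B in P],
      splitting (below j) (above j) [set B :\ i | B in P] &
      [set attach j B | B in [set B :\ i | B in P]] = P].
Proof.
move=> jE /andP[/nc_partitionP[bP cP iP nP]].
move=> /existsP[Bj /andP[BjP /and3P[iBj jBj /forallP minj]]].
have ij := iE jE.
have jNi : j != i by apply: contraTneq ij => ->; rewrite ltnn.
have iBE B : B \in P -> i \in B -> B = Bj by move=> BP iB; apply: iP iBj.
have jBE B : B \in P -> j \in B -> B = Bj by move=> BP jB; apply: iP jBj.
have bE B : B \in P -> B :\ i \subset E.
  move=> BP; apply/subsetP => x; rewrite in_setD1 => /andP[xi xB].
  by apply: Ex => //; apply: (subsetP (bP _ BP).1).
split.
- apply/nc_partitionP; split.
  + move=> _ /imsetP[B BP ->]; split; first exact: bE.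
    have [iB|iB] := boolP (i \in B); first by exists j; rewrite (iBE B) // !inE jNi.
    have [_ [x xB]] := bP _ BP; exists x; rewrite !inE xB andbT.
    by apply: contraTneq xB => ->.
  + move=> x xE; have [|B BP xB] := cP x; first by rewrite !inE xE orbT.
    exists (B :\ i); first exact: imset_f.
    by rewrite !inE xB andbT; apply: contraTneq xE => ->.
  + move=> _ _ x /imsetP[B BP ->] /imsetP[B' B'P ->].
    by rewrite !inE => /andP[_ xB] /andP[_ xB']; rewrite (iP B B' x).
  + move=> _ _ x1 x2 x3 x4 /imsetP[B BP ->] /imsetP[B' B'P ->].
    rewrite !inE => /andP[_ b1] /andP[_ b2] /andP[_ b3] /andP[_ b4] l1 l2 l3.
    by rewrite (nP B B' x1 x2 x3 x4).
- apply/forallP => B'; apply/implyP => /imsetP[B BP {B'}->].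
  have [/existsP[x /andP[xB xj]]|/existsPn hB] :=
    boolP [exists x, (x \in B :\ i) && (x < j)%N]; apply/orP; [left|right].
    apply/subsetP => y yB; rewrite inE (subsetP (bE _ BP) _ yB) /= ltnNge.
    apply/negP => jy; move: xB yB; rewrite !inE => /andP[xi xB] /andP[yi yB].
    have BBj : Bj <> B.
      by move=> e; have := minj x; rewrite e xB (negPf xi) /= leqNgt xj.
    have ix : (i < x)%N by apply/iE/Ex => //; apply: (subsetP (bP _ BP).1).
    have jy' : (j < y)%N.
      rewrite ltn_neqAle jy andbT; apply/eqP => /val_inj e.
      by apply: BBj; rewrite (jBE B) // e.
    by apply: BBj; apply: (nP Bj B i x j y).
  apply/subsetP => y yB; rewrite inE (subsetP (bE _ BP) _ yB) /=.
  by have := hB y; rewrite yB /= -leqNgt.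
- rewrite -imset_comp -[RHS]imset_id; apply: eq_in_imset => B BP /=.
  rewrite /attach !inE jNi /=; case: ifP => jB.
    by rewrite setD1K // (jBE B).
  apply/setP => x; rewrite !inE; case: eqP => // ->.
  by apply/esym/negP => /(iBE _ BP) e; rewrite e jBj in jB.
Qed.

(* Deleting [i] leaves no block straddling [j], as such a block would cross that of [i]. *)
Lemma ncsum_next j w : j \in E ->
  \sum_(P | nc_partition (i |: E) P && next_in_block P j) \prod_(B in P) w B =
  ncsum (below j) w * ncsum (above j) (fun B => w (attach j B)).
Proof.
move=> jE.
rewrite (reindex_onto (fun P : {set {set 'I_n}} => [set attach j B | B in P])
  (fun P : {set {set 'I_n}} => [set B :\ i | B in P])); last first.
  by move=> P /(nc_detach jE)[].
have -> : ncsum (below j) w = ncsum (below j) (fun B => w (attach j B)).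
  apply: eq_ncsum => B /subsetP/(_ j); rewrite !inE ltnn andbF /attach.
  by case: ifP => // _ /(_ isT).
rewrite -ncsum_split; last first.
  by move=> x y; rewrite !inE => /andP[_ xj] /andP[_]; apply: leq_trans.
rewrite below_above; apply: eq_big => [P|P /andP[/andP[PN Pn] /eqP Pd]].
  apply/andP/idP => [[Pi /eqP Pd]|]; last by move=> /(nc_attach jE)[-> -> /eqP].
  by have [h1 h2 _] := nc_detach jE Pi; rewrite -Pd h1.
rewrite big_imset // => B B' BP B'P e.
have iB B0 : B0 \in P -> i \notin B0.
  move=> B0P; have [|/nc_partitionP[bP _ _ _] _ _] :=
    nc_detach (j := j) jE (P := [set attach j B | B in P]); first by rewrite PN Pn.
  by move: B0P; rewrite -{1}Pd => /bP[/subsetP BE _]; apply: contra iNE; apply: BE.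
apply/setP => x; have := congr1 (fun D : {set _} => x \in D) e.
have [->|xi] := eqVneq x i; first by rewrite (negPf (iB _ BP)) (negPf (iB _ B'P)).
by rewrite /attach; case: ifP => _; case: ifP => _; rewrite ?inE ?(negPf xi).
Qed.

(** Partitions are sorted by the second element [j] of the block of [i]; the first term collects
    those in which [i] is alone. *)
Lemma ncsum_first w : ncsum (i |: E) w = w [set i] * ncsum E w +
  \sum_(j in E) ncsum (below j) w * ncsum (above j) (fun B => w (attach j B)).
Proof.
rewrite {1}/ncsum (bigID (fun P => [set i] \in P)) /=; congr (_ + _).
  rewrite -(ncsum1 i) -ncsum_split; last by move=> x y /set1P->; apply: iE.
  apply: eq_bigl => P; apply: andb_id2l => /nc_partitionP[bP cP iP nP].
  apply/idP/forallP => [iPi B|sP].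
    apply/implyP => BP; have [iB|iB] := boolP (i \in B).
      by rewrite (iP B [set i] i) ?inE ?subxx.
    apply/orP; right; apply/subsetP => x xB; apply: Ex.
      by apply: (subsetP (bP _ BP).1).
    by apply: contraNneq iB => <-.
  have [|B BP iB] := cP i; first by rewrite !inE eqxx.
  have := sP B; rewrite BP /= => /orP[]/subsetP sB; last first.
    by have := sB _ iB; rewrite (negPf iNE).
  suff <- : B = [set i] by [].
  by apply/setP => x; rewrite inE; apply/idP/eqP => [/sB/set1P|->].
under [RHS]eq_bigr => j jE do rewrite -ncsum_next //.
have uniq_next P j j' : nc_partition (i |: E) P -> j \in E -> j' \in E ->
    next_in_block P j -> next_in_block P j' -> j = j'.
  move=> /nc_partitionP[bP cP iP nP] jE j'E.
  move=> /existsP[B /andP[BP /and3P[iB jB /forallP/(_ j') mB]]].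
  move=> /existsP[B' /andP[B'P /and3P[iB' jB' /forallP/(_ j) mB']]].
  have e : B = B' by apply: iP iB iB'.
  have ji x : x \in E -> (x == i) = false.
    by move=> xE; apply/negP => /eqP xi; have := iNE; rewrite -xi xE.
  move: mB mB'; rewrite -e in jB' *; rewrite jB jB' !ji //= => h1 h2.
  by apply: val_inj; apply/eqP; rewrite eqn_leq h1 h2.
(* If [i] is not alone, its block has a second element, so the default [i], which lies outside [E],
   is never taken. *)
rewrite (partition_big (fun P => odflt i [pick j in E | next_in_block P j])
  (mem E)) /=; last first.
  move=> P /andP[PN iNP]; case: pickP => [j /andP[//]|no] /=.
  have /nc_partitionP[bP cP iP nP] := PN.
  have [|B BP iB] := cP i; first by rewrite !inE eqxx.
  have [x xB xi] : exists2 x, x \in B & x != i.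
    apply/exists_inP; apply: contraNT iNP => /exists_inPn h.
    suff <- : B = [set i] by [].
    apply/setP => x; rewrite inE; apply/idP/eqP => [/h/negPn/eqP|->] //.
  have xQ : [pred y | (y \in B) && (y != i)] x by rewrite /= xB.
  case: (arg_minnP (fun x : 'I_n => nat_of_ord x) xQ) => j /andP[jB ji] jmin.
  have jE : j \in E by apply: Ex => //; apply: (subsetP (bP _ BP).1).
  have := no j; rewrite jE /=; case/existsP; exists B; rewrite BP iB jB /=.
  apply/forallP => l; apply/implyP => lB; case: eqVneq => //= li.
  by apply: jmin; rewrite /= lB li.
apply: eq_bigr => j jE; apply: eq_bigl => P; rewrite -andbA; apply: andb_id2l => PN.
apply/andP/idP => [[iNP]|Pj].
  by case: pickP => [j' /andP[j'E Pj'] /eqP <- //|_ /= /eqP ij]; have := iNE; rewrite ij jE.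
case: pickP => [j' /andP[j'E Pj']|/(_ j)]; last by rewrite jE Pj.
rewrite (uniq_next P j j') // eqxx; split=> //; apply/negP => iP'.
have /nc_partitionP[_ _ iP _] := PN.
move: Pj => /existsP[B /andP[BP /and3P[iB jB _]]].
have e : B = [set i] by apply: (iP _ _ i) => //; rewrite inE.
by have := iNE; move: jB; rewrite e inE => /eqP <-; rewrite jE.
Qed.

End FirstElement.

End NoncrossingSums.

(** * The first-block recursion computes sums over noncrossing partitions *)

Section NoncrossingMoments.
Variables (R : comNzRingType) (n : nat).
Implicit Types (i j : 'I_n) (l u v p q : seq 'I_n).

Let lt_ord : rel 'I_n := fun x y => (x < y)%N.

Let lt_ord_trans : transitive lt_ord.
Proof. by move=> y x z; apply: ltn_trans. Qed.

(* The single element [i] stands for all the letters of [u]. *)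
Lemma ncsum_open l i (w : {set 'I_n} -> R) k u : path lt_ord i l ->
  (forall v, v <> [::] -> subseq v l -> w [set:: v] = k v) ->
  (forall v, subseq v l -> w (i |: [set:: v]) = k (u ++ v)) ->
  ncsum (i |: [set:: l]) w = open_mom k u l.
Proof.
have [m] := ubnP (size l); elim: m l i w k u => // m IH l i w k u.
rewrite ltnS => lm il wk wu.
have lti : all (lt_ord i) l by apply: order_path_min.
rewrite ncsum_first => [|x]; last by rewrite inE; apply: (allP lti).
have ncmom l' : (size l' <= m)%N -> subseq l' l -> ncsum [set:: l'] w = mom k l'.
  case: l' => [|j l'] l'm jl'; first by rewrite set_nil ncsum0.
  rewrite set_cons (IH _ _ _ k [:: j]) //.
  - have := subseq_sorted lt_ord_trans jl' (path_sorted il) => //.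
  - move=> v v0 vl'; apply: wk => //; apply: subseq_trans jl'.
    exact: subseq_trans vl' (subseq_cons _ _).
  - move=> v vl'; rewrite -set_cons wk //; apply: subseq_trans jl'.
    by rewrite /= eqxx.
rewrite open_momE ncmom // -[[set i]]setU0 -set_nil wu ?sub0seq // cats0.
congr (_ + _).
have ul : uniq l.
  by apply: (sorted_uniq lt_ord_trans _ (path_sorted il)) => x; apply: ltnn.
rewrite (eq_bigl (mem l)) => [|x]; last by rewrite inE.
rewrite -big_uniq //= sum_splits; apply: eq_splits => p j q lE.
have [pj jq] : all (lt_ord^~ j) p /\ all (lt_ord j) q.
  have := path_sorted il; rewrite lE sorted_pairwise // pairwise_cat /=.
  by rewrite allrel_consr => /and4P[/andP[-> _] _ -> _].
have inl x : x \in l = [|| x \in p, x == j | x \in q] by rewrite lE mem_cat inE.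
have pjF x : x \in p -> (x < j)%N by apply: (allP pj).
have jqF x : x \in q -> (j < x)%N by apply: (allP jq).
have -> : [set x in [set:: l] | (x < j)%N] = [set:: p].
  apply/setP => x; rewrite !inE inl; apply/andP/idP => [[]|xp]; last by rewrite xp pjF.
  by case/or3P => // [/eqP->|/jqF]; lia.
have -> : [set x in [set:: l] | (j <= x)%N] = j |: [set:: q].
  apply/setP => x; rewrite !inE inl; apply/andP/idP => [[]|].
    by case/or3P => [/pjF|->|->]; rewrite ?orbT //; lia.
  by case/orP => [/eqP->|xq]; rewrite ?eqxx ?xq ?orbT //= ltnW // jqF.
have [pm qm] : (size p <= m)%N /\ (size q < m)%N.
  by move: lm; rewrite lE size_cat /=; lia.
have pl : subseq p l by rewrite lE prefix_subseq.
have jql : subseq (j :: q) l by rewrite lE suffix_subseq.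
rewrite ncmom //; congr (_ * _).
have jNq : j \notin q by apply/negP => /jqF; rewrite ltnn.
(* Now [j] stands for the letters [rcons u j]: [attach] restores [i], which carries [u], to the
   block of [j]. *)
apply: IH => //.
- by have := subseq_sorted lt_ord_trans jql (path_sorted il).
- move=> v v0 vq; rewrite /attach inE ifF; last first.
    by apply: contraNF jNq; apply: (mem_subseq vq).
  by apply: wk => //; apply: subseq_trans jql; apply: subseq_trans vq (subseq_cons _ _).
- move=> v vq; rewrite /attach !inE eqxx /= -set_cons wu ?cat_rcons //.
  by apply: subseq_trans jql; rewrite /= eqxx.
Qed.

Lemma ncsum_mom l (w : {set 'I_n} -> R) k : sorted lt_ord l ->
  (forall v, v <> [::] -> subseq v l -> w [set:: v] = k v) ->
  ncsum [set:: l] w = mom k l.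
Proof.
case: l => [|i l] il wk; first by rewrite set_nil ncsum0.
rewrite set_cons mom_cons; apply: ncsum_open => // [v v0 vl|v vl].
  by apply: wk => //; apply: subseq_trans vl (subseq_cons _ _).
by rewrite -set_cons wk //= eqxx.
Qed.

End NoncrossingMoments.

Lemma sum_NC_mom (R : comNzRingType) (A : nmodType) (k : seq A -> R) (a : seq A) :
  \sum_(P in NC (size a)) \prod_(B in P) k (subword B) = mom k a.
Proof.
pose lt_ord (x y : 'I_(size a)) := (x < y)%N.
have lt_tr : transitive lt_ord by move=> y x z; apply: ltn_trans.
have sT : sorted lt_ord (enum 'I_(size a)).
  by have := iota_ltn_sorted 0 (size a); rewrite -val_enum_ord sorted_map.
have aE : [seq nth 0 a i | i : 'I_(size a) <- enum 'I_(size a)] = a.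
  by rewrite (map_comp (nth 0 a) val) val_enum_ord; apply: (mkseq_nth 0 a).
rewrite -[RHS](congr1 (mom k) aE) mom_map -(ncsum_mom (w := fun B => k (subword B))) //.
  have -> : [set:: enum 'I_(size a)] = [set: 'I_(size a)].
    by apply/setP => x; rewrite !inE mem_enum.
  by apply: eq_bigl => P; rewrite inE.
move=> v _ vT; rewrite /subword /image_mem; congr (k (map _ _)).
apply: (irr_sorted_eq lt_tr) => [x||| x].
- exact: ltnn.
- by rewrite /enum_mem -enumT; apply: sorted_filter.
- exact: subseq_sorted vT sT.
- by rewrite mem_enum inE.
Qed.

Lemma moment_mom (C : numClosedFieldType) (A : starAlgType C) (phi : {scalar A})
  (a : seq A) : a <> [::] -> phi (\prod_(x <- a) x) = mom (cumulant phi) a.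
Proof. by move=> /eqP a0; rewrite moment_cumulant // sum_NC_mom. Qed.

(** * R-diagonality in terms of word moments *)

Lemma alternating_path b s : path differ b s -> height (b :: s) = 0 ->
  exists k, b :: s = flatten (nseq k [:: b; ~~ b]).
Proof.
have [n] := ubnP (size s); elim: n b s => // n IH b [|c [|d s]] /=.
- by move=> _ _; rewrite height_cons height_nil; case: b.
- by move=> _ /andP[bc _] _; exists 1; case: b c bc => [] [].
- move=> sn /and3P[bc cd ds] h; have db : d = b by case: b c d bc cd {h ds} => [] [] [].
  have cb : c = ~~ b by case: b c bc {h cd db} => [] [].
  have [||k dsE] := IH d s _ ds; first by lia.
    move: h; rewrite cb height_cons [height (_ :: _ :: _)]height_cons /exponent.
    by case: (b) => /=; lia.
  by exists k.+1; rewrite dsE cb db.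
Qed.

Lemma sorted_alternating b k :
  sorted differ (flatten (nseq k [:: b; ~~ b])) /\
  height (flatten (nseq k [:: b; ~~ b])) = 0.
Proof.
elim: k => [|k [IHs IHh]] /=; first by rewrite height_nil.
rewrite !height_cons IHh; split; last by case: (b).
by case: k IHs {IHh} => [|k] /=; case: (b).
Qed.

Lemma alternatingP s :
  reflect (alternating s) (sorted differ s && (height s == 0)).
Proof.
apply: (iffP andP) => [[ss /eqP hs]|[k]]; last first.
  by move=> [] ->; [have [-> ->] := sorted_alternating false k|
                    have [-> ->] := sorted_alternating true k].
case: s ss hs => [|b s] /= bs hs; first by exists 0; left.
have [k ->] := alternating_path bs hs.
by exists k; case: b {bs hs} => /=; [right|left].
Qed.

(** Cut the word between any two equal neighbouring letters. *)
Lemma chain_decomp x s : exists2 ws, chain x ws & flatten ws = x :: s.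
Proof.
elim: s x => [|y s IH] x; first by exists [:: [:: x]]; rewrite //= eqxx.
have [[//|[|z v] ws] //= /and3P[/eqP-> yv ch] [sE]] := IH y.
have [->|xy] := eqVneq x y.
  by exists [:: [:: y], y :: v & ws]; rewrite /= ?eqxx ?yv ?ch ?sE.
by exists ((x :: y :: v) :: ws); rewrite /= ?eqxx ?xy ?yv ?ch ?sE // /differ xy.
Qed.

Lemma chain_blocks y ws : chain y ws -> (1 < size ws)%N ->
  all (fun w => 0 < size w < size (flatten ws))%N ws.
Proof.
move=> ch ws1; have ws0 w : w \in ws -> (0 < size w)%N.
  move: ch {ws1}; elim: ws y => //= -[//|x v] ws IH y /and3P[_ _ /IH{}IH].
  by rewrite inE => /predU1P[->|/IH].
apply/allP => w wws; rewrite ws0 //=.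
case/splitPr: wws ws1 ws0 {ch} => p q; rewrite flatten_cat /= !size_cat.
case: p => [|v p]; case: q => [|v' q] //= _ ws0; rewrite ?size_cat.
- by have := ws0 v'; rewrite !inE eqxx orbT => /(_ isT); lia.
- by have := ws0 v; rewrite !inE eqxx => /(_ isT); lia.
- by have := ws0 v; rewrite !inE eqxx => /(_ isT); lia.
Qed.

Section WordMoments.
Variables (C : numClosedFieldType) (A : starAlgType C) (phi : {scalar A}) (a : A).
Hypothesis phi1 : phi 1 = 1.

Definition word_moment s : C := phi (word a s).

Definition word_cumulant s : C := cumulant phi [seq star_pow a b | b <- s].

Lemma word_momentE s : word_moment s = mom word_cumulant s.
Proof.
case: s => [|b s]; first by rewrite /word_moment /word big_nil phi1.
by rewrite /word_moment /word -(big_map (star_pow a) predT id) moment_mom // mom_map.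
Qed.

Let Rdiag_part s : C :=
  if sorted differ s && (height s == 0) then word_cumulant s else 0.

Let mom_part : RdiagMoments (mom Rdiag_part).
Proof.
apply: mom_Rdiag => u hu; rewrite /Rdiag_part; first by rewrite (negPf hu).
by rewrite (negPf hu) andbF.
Qed.

Lemma Rdiag_moments : R_diagonal phi a <-> RdiagMoments word_moment.
Proof.
split=> [Rd|[m1 mh mc] s /eqP s0 /alternatingP s_alt].
  have cE s : s <> [::] -> word_cumulant s = Rdiag_part s.
    move=> /eqP s0; rewrite /Rdiag_part; case: alternatingP => // s_alt.
    exact: Rd.
  have mE s : word_moment s = mom Rdiag_part s.
    by rewrite word_momentE; apply: mom_eq cE.
  have [p1 ph pc] := mom_part; split=> [|s|y ws ch ws0]; rewrite ?mE //.
    exact: ph.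
  rewrite -(pc y ws ch ws0).
  by apply: (eq_centered_lt (n := (size ([::] ++ flatten ws ++ [::])).+1)).
suff cE n t : t <> [::] -> (size t < n)%N -> word_cumulant t = Rdiag_part t.
  by rewrite -[LHS]/(word_cumulant s) (cE (size s).+1) // /Rdiag_part (negPf s_alt).
elim: n t => // n IH t t0; rewrite ltnS => tn.
have IHt u : u <> [::] -> (size u < size t)%N -> word_cumulant u = Rdiag_part u.
  by move=> u0 ut; apply: IH => //; apply: leq_trans tn.
(* All shorter cumulants agree, so the cumulants at [t] agree exactly when the moments do. *)
apply/eqP; rewrite -subr_eq0 -mom_sub // subr_eq0; apply/eqP.
rewrite -word_momentE.
have mE u : (size u < size t)%N -> word_moment u = mom Rdiag_part u.
  by move=> ut; rewrite word_momentE; apply: mom_lt ut.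
have [p1 ph pc] := mom_part.
have [t_alt|] := boolP (sorted differ t && (height t == 0)).
  apply/eqP; rewrite -subr_eq0 word_momentE mom_sub // subr_eq0.
  by rewrite /Rdiag_part t_alt.
rewrite negb_and; have [h|h _] := eqVneq (height t) 0; last by rewrite mh ?ph.
rewrite orbF; case: t t0 {tn IHt} mE h => // x t _ mE h xt.
(* Here [t] repeats a letter, so it is cut into at least two factors. Both centered products vanish,
   and they express the two moments by the same shorter moments. *)
have [ws ch wsE] := chain_decomp x t.
have ws0 : ws != [::] by case: (ws) wsE.
have ws1 : (1 < size ws)%N.
  case: (ws) ch wsE => [|v [|//]] //=; rewrite cats0 => + vE.
  by rewrite vE /= => /and3P[_ xt' _]; rewrite /= xt' in xt.
have := chain_blocks ch ws1; rewrite wsE => blk.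
have := centered_sub (u := [::]) (v := [::]) mE blk.
rewrite /= cats0 wsE (mc x) // (pc x) // subrr => /(_ (leqnn _))/esym/eqP.
by rewrite subr_eq0 => /eqP.
Qed.

End WordMoments.

(** * Freeness *)

From mathcomp Require Import complex.
From mathcomp Require Import boolp classical_sets reals.
Local Open Scope complex_scope.
Local Open Scope classical_set_scope.

Section Spans.
Variables (C : numClosedFieldType) (A : starAlgType C).
Implicit Types (X Y : set A) (x y : A) (P : A -> Prop).

Lemma linear_span_ind X P : P 0 ->
  (forall c x y, P x -> P y -> P (c *: x + y)) -> X `<=` P ->
  linear_span X `<=` P.
Proof.
move=> P0 PL PX x /(_ (P : set A)); apply; split=> //; split; first exact/mem_set.
by move=> c y z /set_mem Py /set_mem Pz; apply/mem_set/PL.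
Qed.

Lemma linear_span_sub X : X `<=` linear_span X.
Proof. by move=> x Xx V [_]; apply. Qed.

Lemma linear_span0 X : linear_span X 0.
Proof. by move=> V [[V0 _] _]; apply: set_mem. Qed.

Lemma linear_spanL X c x y :
  linear_span X x -> linear_span X y -> linear_span X (c *: x + y).
Proof.
move=> Xx Xy V VX; have [[_ VL] _] := VX.
by apply/set_mem/VL; apply/mem_set; [apply: Xx|apply: Xy].
Qed.

Lemma linear_span_mul X Y Z :
  (forall x y, X x -> Y y -> linear_span Z (x * y)) ->
  forall x y, linear_span X x -> linear_span Y y -> linear_span Z (x * y).
Proof.
move=> XY x y Xx Yy; pose P y := linear_span Z (x * y); rewrite -/(P y).
apply: linear_span_ind Yy => {y} [|c y z IHy IHz|y Yy]; rewrite /P.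
- by rewrite mulr0; apply: linear_span0.
- by rewrite mulrDr -scalerAr; apply: linear_spanL.
pose Q x := linear_span Z (x * y); rewrite -/(Q x).
apply: linear_span_ind Xx => {P x} [|c x z IHx IHz|x Xx]; rewrite /Q.
- by rewrite mul0r; apply: linear_span0.
- by rewrite mulrDl -scalerAl; apply: linear_spanL.
exact: XY.
Qed.

Lemma generated_algebra_sub X : X `<=` generated_algebra X.
Proof. by move=> x Xx V [_]; apply. Qed.

Lemma generated_algebra1 X : generated_algebra X 1.
Proof. by move=> V [[V1 _ _] _]; apply: set_mem. Qed.

Lemma generated_algebraL X c x y : generated_algebra X x ->
  generated_algebra X y -> generated_algebra X (c *: x + y).
Proof.
move=> Xx Xy V VX; have [[_ VL _] _] := VX.
by apply/set_mem/VL; apply/mem_set; [apply: Xx|apply: Xy].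
Qed.

Lemma generated_algebraM X x y : generated_algebra X x ->
  generated_algebra X y -> generated_algebra X (x * y).
Proof.
move=> Xx Xy V VX; have [[_ _ VM] _] := VX.
by apply/set_mem/VM; apply/mem_set; [apply: Xx|apply: Xy].
Qed.

Lemma generated_algebra_ind X P : P 1 ->
  (forall c x y, P x -> P y -> P (c *: x + y)) ->
  (forall x y, P x -> P y -> P (x * y)) -> X `<=` P ->
  generated_algebra X `<=` P.
Proof.
move=> P1 PL PM PX x /(_ (P : set A)); apply; split=> //; split; first exact/mem_set.
  by move=> c y z /set_mem Py /set_mem Pz; apply/mem_set/PL.
by move=> y z /set_mem Py /set_mem Pz; apply/mem_set/PM.
Qed.

End Spans.

(** * Words in an element and its adjoint *)

Section Words.
Variables (C : numClosedFieldType) (A : starAlgType C) (phi : {scalar A}) (a : A).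
Implicit Types (s t u v w : seq bool) (ws g : seq (seq bool)).

Lemma word_cat s t : word a (s ++ t) = word a s * word a t.
Proof. by rewrite /word big_cat. Qed.

Lemma word_nil : word a [::] = 1. Proof. by rewrite /word big_nil. Qed.

Notation mu := (word_moment phi a).

Definition centered_word w : A := word a w - (mu w)%:A.

Definition centered_prod ws : A := \prod_(w <- ws) centered_word w.

Lemma centered_prod_cons w ws :
  centered_prod (w :: ws) = centered_word w * centered_prod ws.
Proof. by rewrite /centered_prod big_cons. Qed.

Lemma centered_prod_cat ws1 ws2 :
  centered_prod (ws1 ++ ws2) = centered_prod ws1 * centered_prod ws2.
Proof. by rewrite /centered_prod big_cat. Qed.

Lemma word_centered u w ws : word a u * centered_prod (w :: ws) =
  word a (u ++ w) * centered_prod ws - mu w *: (word a u * centered_prod ws).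
Proof.
rewrite centered_prod_cons mulrA /centered_word mulrBr mulrBl word_cat.
by rewrite mulr_algr scalerAl.
Qed.

Lemma phi_centered u ws :
  phi (word a u * centered_prod ws) = centered mu mu u ws [::].
Proof.
elim: ws u => [|w ws IH] u; first by rewrite /centered_prod big_nil mulr1 /= cats0.
by rewrite word_centered linearB linearZ !IH.
Qed.

Lemma phi_centered_prod ws : phi (centered_prod ws) = centered mu mu [::] ws [::].
Proof. by rewrite -phi_centered word_nil mul1r. Qed.

Lemma word_scale z s : `|z| = 1 -> word (z *: a) s = z ^ height s *: word a s.
Proof.
move=> z1; have z0 : z != 0 by rewrite -normr_gt0 z1 ltr01.
elim: s => [|b s IH]; first by rewrite /word !big_nil height_nil scale1r.
rewrite /word !big_cons -/(word _ _) -/(word _ _) {}IH height_cons expfzDr //.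
have -> : star_pow (z *: a) b = z ^ exponent b *: star_pow a b.
  case: b => //=; rewrite starZ; congr (_ *: _).
  by rewrite exprN1 invC_norm z1 expr1n invr1 mul1r.
by rewrite -scalerAl -scalerAr scalerA.
Qed.

Lemma same_distribution_scale :
  (forall z : C, `|z| = 1 -> same_distribution phi a (z *: a)) <->
  (forall s, height s != 0 -> mu s = 0).
Proof.
split=> [sd s hs|mu0 z z1 s].
  (* For such a [z], invariance reads [mu s = - mu s]. A root of -1 whose degree is the absolute
     height has modulus one, and inverting -1 covers negative heights. *)
  have [z zE] : exists z : C, `|z| = 1 /\ z ^ height s = -1.
    pose n := absz (height s); have n0 : (0 < n)%N by rewrite absz_gt0.
    pose z : C := n.-root (-1); have zn : z ^+ n = -1 by apply: rootCK.
    exists z; split.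
      apply/eqP; rewrite -(@pexpr_eq1 _ _ n) ?normr_ge0 // -normrX zn normrN1.
      by rewrite eqxx.
    case: (height s) @n n0 @z zn => m n n0 z zn; first exact: zn.
    by rewrite NegzE -exprnN zn invrN1.
  have := sd z zE.1 s; rewrite word_scale ?zE.1 // zE.2 linearZ /= -/(mu s) mulN1r.
  by move/eqP; rewrite -addr_eq0 -mulr2n mulrn_eq0 /= => /eqP.
rewrite word_scale // linearZ /= -/(mu s).
have [->|/mu0->] := eqVneq (height s) 0; first by rewrite mul1r.
by rewrite mulr0.
Qed.

End Words.

(** Every [j] is allowed, including 0 and indices past the end, so no bounds have to be carried
    along; [balancedE] returns to the bounded form. *)
Definition nonpositive s := forall j, height (take j s) <= 0.

Lemma nonpositive_cat s t : nonpositive s ->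
  (forall j, height s + height (take j t) <= 0) -> nonpositive (s ++ t).
Proof.
move=> ns st j; rewrite take_cat; case: ifP => // _.
by rewrite height_cat.
Qed.

(** A prefix that ends after the removed word keeps its height. This keeps words balanced when a
    factor is replaced by its mean. *)
Lemma nonpositive_remove u w v : nonpositive (u ++ w ++ v) -> height w = 0 ->
  nonpositive (u ++ v).
Proof.
move=> n w0 j; rewrite take_cat; case: ltnP => ju.
  by have := n j; rewrite take_cat ju.
have := n (j + size w)%N; rewrite take_cat ltnNge (leq_trans ju (leq_addr _ _)) /=.
rewrite take_cat ifF; last by apply/negbTE; rewrite -leqNgt; lia.
rewrite !height_cat w0 add0r.
by have -> : (j + size w - size u - size w = j - size u)%N by lia.
Qed.

Definition balanced0 : set (seq bool) := [set s | height s = 0 /\ nonpositive s].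

Lemma balanced0_cat s t : balanced0 s -> balanced0 t -> balanced0 (s ++ t).
Proof.
move=> [s0 ns] [t0 nt]; split; first by rewrite height_cat s0 t0.
by apply: nonpositive_cat => // j; rewrite s0 add0r.
Qed.

Lemma balancedE s : balanced s <-> s <> [::] /\ balanced0 s.
Proof.
split=> [[/eqP s0 h n]|[s0 [h n]]].
  split=> //; split=> // j; case: (posnP j) => [->|j0]; first by rewrite take0 height_nil.
  case: (ltnP j (size s)) => js; first by apply: n; rewrite j0.
  by rewrite take_oversize // /height h.
by split=> [|//|j _]; [apply/eqP|apply: n].
Qed.

Definition aastar_word : set (seq bool) :=
  [set s | exists k, s = flatten (nseq k [:: false; true])].

Lemma aastar_word_cat s t : aastar_word s -> aastar_word t -> aastar_word (s ++ t).
Proof. by move=> [k ->] [l ->]; exists (k + l)%N; rewrite nseqD flatten_cat. Qed.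

(** * The two algebras as spans of words and of centered products *)

Section Freeness.
Variables (C : numClosedFieldType) (A : starAlgType C) (phi : {scalar A}) (a : A).
Implicit Types (s t u v w : seq bool) (ws g : seq (seq bool)) (x y : A).

Notation mu := (word_moment phi a).
Notation cword := (centered_word phi a).
Notation cprod := (centered_prod phi a).

Definition word_span (P : set (seq bool)) : set A := linear_span [set word a s | s in P].

Lemma word_span_algebra (P : set (seq bool)) X : P [::] ->
  (forall s t, P s -> P t -> P (s ++ t)) -> X `<=` word_span P ->
  generated_algebra X `<=` word_span P.
Proof.
move=> P0 PM XP; apply: generated_algebra_ind => //.
- by apply: linear_span_sub; exists [::]; rewrite ?word_nil.
- exact: linear_spanL.
apply: linear_span_mul => _ _ [s Ps <-] [t Pt <-].
by apply: linear_span_sub; exists (s ++ t); [apply: PM|rewrite word_cat].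
Qed.

Lemma generated_aastar :
  generated_algebra [set a * star a] `<=` word_span aastar_word.
Proof.
apply: word_span_algebra; first by exists 0.
  exact: aastar_word_cat.
move=> _ ->; apply: linear_span_sub; exists [:: false; true]; first by exists 1.
by rewrite /word !big_cons big_nil mulr1.
Qed.

Lemma generated_K : generated_algebra (K_alg a) `<=` word_span balanced0.
Proof.
apply: word_span_algebra.
- by split=> [|j]; rewrite ?height_nil.
- exact: balanced0_cat.
apply: linear_span_ind; [exact: linear_span0|exact: linear_spanL|].
by move=> _ [s /balancedE[_ s0] <-]; apply: linear_span_sub; exists s.
Qed.

(** Both end letters are recorded because two products concatenate to a chain when the last letter
    of the first is the first letter of the second. *)
Definition chain_span (b e : bool) : set A :=
  linear_span [set x | exists ws,
    [/\ ws != [::], chain b ws, last b (flatten ws) = e & x = cprod ws]].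

Lemma chain_span_mul b c e x y :
  chain_span b c x -> chain_span c e y -> chain_span b e (x * y).
Proof.
apply: linear_span_mul => {}x {}y [ws [w0 bw <- ->]] [ws' [w'0 bw' <- ->]].
apply: linear_span_sub; exists (ws ++ ws'); split.
- by case: (ws) w0.
- by rewrite chain_cat bw.
- by rewrite flatten_cat last_cat.
- by rewrite centered_prod_cat.
Qed.

(** * Freeness from vanishing centered products *)

Section RdiagFree.
Hypothesis phi1 : phi 1 = 1.
Hypothesis mu_diag : RdiagMoments mu.

Let mu0 s : height s != 0 -> mu s = 0. Proof. by case: mu_diag => _ /(_ s). Qed.

Lemma phi_chain_span b e x : chain_span b e x -> phi x = 0.
Proof.
have [_ _ mc] := mu_diag; move: x; apply: linear_span_ind.
- exact: linear0.
- by move=> c x y px py; rewrite linearP /= px py mulr0 addr0.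
by move=> _ [ws [w0 bw _ ->]]; rewrite /= phi_centered_prod (mc b).
Qed.

(** Scalars plus chains from [b] to [~~ b]: the common shape of the elements generated by
    [a * star a], with [b = false], and by [K_alg a], with [b = true]. *)
Let upto (b : bool) : set A := [set x | exists c : C, chain_span b (~~ b) (x - c%:A)].

Let upto_lin b c x y : upto b x -> upto b y -> upto b (c *: x + y).
Proof.
move=> [d xd] [e ye]; exists (c * d + e).
have -> : c *: x + y - (c * d + e)%:A = c *: (x - d%:A) + (y - e%:A).
  by rewrite scalerBr scalerA scalerDl opprD addrACA.
exact: linear_spanL.
Qed.

Let upto_sub b : chain_span b (~~ b) `<=` upto b.
Proof. by move=> x xb; exists 0; rewrite scale0r subr0. Qed.

Let upto1 b : upto b 1.
Proof. by exists 1; rewrite scale1r subrr; apply: linear_span0. Qed.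

(** Chains have mean zero, so the scalar part is the value of [phi]. *)
Let upto_phi b x : upto b x -> phi x = 0 -> chain_span b (~~ b) x.
Proof.
move=> [c xc] x0; have := phi_chain_span xc.
rewrite linearB linearZ /= x0 phi1 mulr1 sub0r => /eqP; rewrite oppr_eq0 => /eqP c0.
by move: xc; rewrite c0 scale0r subr0.
Qed.

Let upto_word_span b (P : set (seq bool)) :
  (forall s, P s -> upto b (word a s)) -> word_span P `<=` upto b.
Proof.
move=> Pu; apply: linear_span_ind; last by move=> _ [s Ps <-]; apply: Pu.
  by exists 0; rewrite scale0r subr0; apply: linear_span0.
by move=> c x y; apply: upto_lin.
Qed.

Let upto_aastar s : aastar_word s -> upto false (word a s).
Proof.
case=> [[|k] ->]; first by rewrite word_nil.
have [ss h] := sorted_alternating false k.+1.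
exists (mu (flatten (nseq k.+1 [:: false; true]))); apply: linear_span_sub.
exists [:: flatten (nseq k.+1 [:: false; true])]; split=> //=.
- by rewrite andbT; exact: ss.
- by rewrite cats0 /= -/(flatten _); elim: k {ss h}.
- by rewrite centered_prod_cons /centered_prod big_nil mulr1.
Qed.

(** Induction on length: cut the word at its repeated letters and center the pieces. The correction
    consists of shorter words with some pieces removed; only pieces of height 0 have nonzero mean,
    so these words are again balanced. *)
Let upto_balanced s : balanced0 s -> upto true (word a s).
Proof.
have [n] := ubnP (size s); elim: n s => // n IH s; rewrite ltnS => sn s0.
have small ws u : (size (u ++ flatten ws) < n)%N -> balanced0 (u ++ flatten ws) ->
    upto true (word a u * cprod ws).
  elim: ws u => [|w ws IHw] u.
    by rewrite /= cats0 /centered_prod big_nil mulr1; apply: IH.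
  rewrite /= word_centered => un u0.
  have uw : upto true (word a (u ++ w) * cprod ws) by apply: IHw; rewrite -catA.
  have [w0|/mu0->] := eqVneq (height w) 0; last by rewrite scale0r subr0.
  rewrite addrC -scaleNr; apply: upto_lin => //; apply: IHw.
    by move: un; rewrite !size_cat; lia.
  case: u0 => h np; split; last exact: nonpositive_remove np w0.
  by move: h; rewrite !height_cat w0 add0r.
have diff ws u : all (fun w => w != [::]) ws -> (size (u ++ flatten ws) <= n)%N ->
    balanced0 (u ++ flatten ws) ->
    upto true (word a (u ++ flatten ws) - word a u * cprod ws).
  elim: ws u => [|w ws IHw] u /=.
    by move=> _ _ _; rewrite cats0 /centered_prod big_nil mulr1 subrr -(scale0r 1);
      rewrite -[X in upto _ X]addr0; apply: upto_lin => //; exists 0;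
      rewrite scale0r subr0; apply: linear_span0.
  move=> /andP[wn wsn] un u0; rewrite word_centered opprB addrC -addrA [- _ + _]addrC.
  rewrite [word a (_ ++ _ ++ _)]word_cat -word_cat catA.
  have uw : upto true (word a ((u ++ w) ++ flatten ws) - word a (u ++ w) * cprod ws).
    by apply: IHw; rewrite -?catA.
  have [w0|/mu0->] := eqVneq (height w) 0; last by rewrite scale0r add0r.
  apply: upto_lin => //; apply: small.
    apply: leq_trans un; rewrite !size_cat ltn_add2l -[ltnLHS]add0n ltn_add2r.
    by rewrite lt0n size_eq0.
  case: u0 => h np; split; last exact: nonpositive_remove np w0.
  by move: h; rewrite !height_cat w0 add0r.
case: s sn s0 => [|x s] sn s0; first by rewrite word_nil.
have [ws ch wsE] := chain_decomp x s.
have wsn : all (fun w => w != [::]) ws.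
  by move: ch {wsE}; elim: (ws) (x) => //= -[//|z v] ws' IHw y /and3P[_ _ /IHw].
(* A path from 0 to 0 that never rises above 0 starts with a down step [star a] and ends with an up
   step [a]. *)
have x1 : x = true.
  by have := s0.2 1%N; rewrite /= take0 height_cons height_nil; case: (x).
have lx : last true (flatten ws) = false.
  rewrite wsE /=; case: s0 => h np; move: h np; case/lastP: s {sn wsE} => [|s z].
    by rewrite x1 height_cons height_nil.
  move=> h /(_ (size s).+1); rewrite last_rcons /= -cats1 take_size_cat //.
  move: h; rewrite -rcons_cons height_rcons => h.
  by case: (z) h; rewrite /exponent => h h'; lia.
have := diff ws [::] wsn; rewrite wsE word_nil mul1r => /(_ sn s0) d.
have cu : upto true (cprod ws).
  apply: upto_sub; apply: linear_span_sub; exists ws; rewrite lx -{1}x1; split=> //.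
  by case: (ws) wsE.
by have := upto_lin 1 cu d; rewrite scale1r addrC subrK.
Qed.

(** Centered elements of the algebra with index [b] are chains from [b] to [~~ b]. As neighbouring
    indices differ, the factors glue to one long chain, on which [phi] vanishes. *)
Lemma Rdiag_free : free_pair phi [set a * star a] (K_alg a).
Proof.
move=> [//|n] s x _ gx x0 sn.
have sx j : (j < n.+1)%N -> chain_span (s j) (~~ s j) (x j).
  move=> jn; apply: upto_phi; last exact: x0.
  have := gx j jn; case: (s j) => [/generated_K|/generated_aastar].
    exact: (upto_word_span upto_balanced).
  exact: (upto_word_span upto_aastar).
suff : chain_span (s 0%N) (~~ s n) (\prod_(0 <= j < n.+1) x j) by apply: phi_chain_span.
elim: n {gx x0} sn sx => [|n IH] sn sx; first by rewrite big_nat1; apply: sx.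
rewrite big_nat_recr //=; apply: chain_span_mul (sx _ (ltnSn _)).
have -> : s n.+1 = ~~ s n by have := sn n (ltnSn _); case: (s n) (s n.+1) => [] [].
by apply: IH => j jn; [apply: sn|apply: sx]; apply: ltnW.
Qed.

End RdiagFree.
End Freeness.

(* The cycle lemma: rotate to a position of maximal height. *)
Lemma rot_nonpositive (ws : seq (seq bool)) : height (flatten ws) = 0 ->
  exists r, forall j, height (flatten (take j (rot r ws))) <= 0.
Proof.
move=> h0; pose S j := height (flatten (take j ws)).
have Sle j : (size ws <= j)%N -> S j = 0 by move=> jw; rewrite /S take_oversize.
have [r rmax] : exists r : 'I_(size ws).+1, forall j : 'I_(size ws).+1, S j <= S r.
  by case: (@arg_maxP _ _ _ ord0 predT (fun j : 'I_(size ws).+1 => S j) isT)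
    => r _ rmax; exists r => j; apply: rmax.
have Smax j : S j <= S r.
  case: (ltnP j (size ws).+1) => [jw|/ltnW jw]; first exact: (rmax (Ordinal jw)).
  by rewrite (Sle j jw) -(Sle (size ws)) //; exact: (rmax ord_max).
exists r => j; have rw : (r <= size ws)%N by rewrite -ltnS.
rewrite /rot take_cat size_drop; case: ltnP => jr.
  have -> : height (flatten (take j (drop r ws))) = S (r + j)%N - S r.
    by rewrite /S takeD flatten_cat height_cat addrC addKr.
  by rewrite subr_le0.
rewrite flatten_cat height_cat.
have -> : height (flatten (drop r ws)) = - S r.
  by apply/eqP; rewrite -addr_eq0 addrC -height_cat -flatten_cat cat_take_drop h0.
have [jr'|jr'] := leqP (j - (size ws - r)) r.
  by rewrite take_takel // addrC subr_le0; apply: Smax.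
by rewrite take_oversize ?addNr // size_take; case: ifP; lia.
Qed.

(** This controls the path inside a factor when only its level at the breakpoints is known. *)
Lemma height_take_alternating b s j : path differ b s ->
  height (take j (b :: s)) <= if b then 0 else 1.
Proof.
case: j => [|j] bs; first by rewrite take0 height_nil; case: b {bs}.
rewrite /= height_alternating ?take_path //; case: ifP => _; by case: (b).
Qed.

(** * Vanishing centered products from freeness *)

Section Converse.
Variables (C : numClosedFieldType) (A : starAlgType C) (phi : {scalar A}) (a : A).
Implicit Types (s t u v w : seq bool) (ws g : seq (seq bool)) (x y : A).

Notation mu := (word_moment phi a).
Notation cword := (centered_word phi a).
Notation cprod := (centered_prod phi a).

Hypothesis phi1 : phi 1 = 1.
Hypothesis phi_tr : tracial phi.
Hypothesis mu0 : forall s, height s != 0 -> mu s = 0.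
Hypothesis a_free : free_pair phi [set a * star a] (K_alg a).

Let side (b : bool) : set A := generated_algebra (if b then K_alg a else [set a * star a]).

Let free_list (L : seq (bool * A)) : L != [::] ->
  sorted differ (unzip1 L) ->
  (forall p, p \in L -> side p.1 p.2 /\ phi p.2 = 0) ->
  phi (\prod_(p <- L) p.2) = 0.
Proof.
move=> L0 Ls LP; rewrite (big_nth (false, 0)).
have L0' : (0 < size L)%N by rewrite lt0n size_eq0.
apply: (a_free (s := fun j => (nth (false, 0) L j).1)) => // j jL.
- by have [] := LP _ (mem_nth (false, 0) jL).
- by have [] := LP _ (mem_nth (false, 0) jL).
rewrite -!(nth_map (false, 0) false fst) ?(ltnW jL) //.
apply/eqP; have := sortedP false Ls j; rewrite size_map => /(_ jL).
by rewrite /differ.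
Qed.

Let side_L b c x y : side b x -> side b y -> side b (c *: x + y).
Proof. exact: generated_algebraL. Qed.

Let side1 b : side b 1. Proof. exact: generated_algebra1. Qed.

Let side_centered b w : side b (word a w) -> side b (cword w).
Proof.
move=> bw; rewrite /centered_word addrC -scaleNr; exact: side_L.
Qed.

Let side_balanced s : balanced0 s -> side true (word a s).
Proof.
move=> s0; have [->|sn] := eqVneq s [::]; first by rewrite word_nil.
apply: generated_algebra_sub; apply: linear_span_sub; exists s => //.
by apply/balancedE; split=> //; apply/eqP.
Qed.

Let side_aastar s : aastar_word s -> side false (word a s).
Proof.
case=> k ->; elim: k => [|k IH]; first by rewrite word_nil.
rewrite -[flatten _]/([:: false; true] ++ flatten (nseq k [:: false; true])).
rewrite word_cat; apply: generated_algebraM => //; apply: generated_algebra_sub.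
by rewrite /word !big_cons big_nil mulr1.
Qed.

Let side_cprod u g : balanced0 (u ++ flatten g) -> side true (word a u * cprod g).
Proof.
elim: g u => [|w g IH] u /=.
  by rewrite cats0 /centered_prod big_nil mulr1; apply: side_balanced.
rewrite word_centered => u0.
have uw : side true (word a (u ++ w) * cprod g) by apply: IH; rewrite -catA.
have [w0|/mu0->] := eqVneq (height w) 0; last by rewrite scale0r subr0.
rewrite addrC -scaleNr; apply: side_L => //; apply: IH.
case: u0 => h np; split; last exact: nonpositive_remove np w0.
by move: h; rewrite !height_cat w0 add0r.
Qed.

Let phi_cword w : phi (cword w) = 0.
Proof. by rewrite linearB linearZ /= phi1 mulr1 subrr. Qed.

Section Step.
Variable N : nat.
Hypothesis IH : forall (b : bool) ws, (size (flatten ws) < N)%N -> chain b ws ->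
  ws != [::] -> phi (cprod ws) = 0.

(* [g] is the current run of factors below level 0; it is pushed on the alternating
   list [L] when the next factor rises above level 0. *)
Let free_run vs g (L : seq (bool * A)) :
  L != [::] -> sorted differ (unzip1 L) -> last true (unzip1 L) = false ->
  (forall p, p \in L -> side p.1 p.2 /\ phi p.2 = 0) ->
  chain true (g ++ vs) -> nonpositive (flatten g) ->
  (forall j, height (flatten g) + height (flatten (take j vs)) <= 0) ->
  height (flatten (g ++ vs)) = 0 -> (size (flatten (g ++ vs)) < N)%N ->
  phi (\prod_(p <- L) p.2 * cprod g * cprod vs) = 0.
Proof.
have push L' b x : L' != [::] -> sorted differ (unzip1 L') ->
    last true (unzip1 L') = ~~ b ->
    (forall p, p \in L' -> side p.1 p.2 /\ phi p.2 = 0) -> side b x -> phi x = 0 ->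
    [/\ L' ++ [:: (b, x)] != [::], sorted differ (unzip1 (L' ++ [:: (b, x)])) &
     forall p, p \in L' ++ [:: (b, x)] -> side p.1 p.2 /\ phi p.2 = 0].
  move=> L0 Ls Ll LP bx x0; split; first by case: (L') L0.
    rewrite /unzip1 map_cat cats1; case: (L') L0 Ls Ll => //= p L'' _ pL lE.
    by rewrite rcons_path pL lE /differ; case: (b).
  by move=> p; rewrite mem_cat inE => /orP[/LP //|/eqP->].
elim: vs g L => [|v vs IHv] g L L0 Ls Ll LP ch np hp h sN.
  rewrite {2}/centered_prod big_nil mulr1.
  rewrite cats0 in ch h sN.
  have [->|g0] := eqVneq g [::].
    by rewrite /centered_prod big_nil mulr1; apply: free_list.
  have [||L0' Ls' LP'] := push L true (cprod g) L0 Ls Ll LP.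
  - by rewrite -[cprod g]mul1r -(word_nil a); apply: side_cprod; split.
  - exact: IH sN ch g0.
  by have := free_list L0' Ls' LP'; rewrite big_cat big_seq1.
case: v ch hp h sN => [|x w]; first by rewrite chain_cat /= andbF.
move=> ch hp h sN.
have := ch; rewrite chain_cat /= => /and4P[chg /eqP xl xw chv].
(* At level 0, a factor beginning with [a] must come back to level 0, as no breakpoint is positive.
   It is then a centered power of [a * star a] and ends the run [g], which is nonempty because the
   last index on [L] is [false] and runs begin with [star a]. *)
have [/andP[/eqP hg /eqP xf]|gx] := boolP ((height (flatten g) == 0) && (x == false)).
  have hv : height (x :: w) = 0.
    have := hp 1%N; rewrite /= take0 cats0 hg add0r height_alternating // xf.
    by case: (last false w).
  have lw : last x w = true.
    by move: hv; rewrite height_alternating // xf; case: (last false w).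
  have g0 : g != [::] by apply: contra_eq_neq xl => ->; rewrite xf.
  have [||L0' Ls' LP'] := push L true (cprod g) L0 Ls Ll LP.
  - by rewrite -[cprod g]mul1r -(word_nil a); apply: side_cprod; split.
  - by apply: IH chg g0; move: sN; rewrite flatten_cat size_cat; clear; lia.
  have [|||L0'' Ls'' LP''] := push _ false (cword (x :: w)) L0' Ls' _ LP'.
  - by rewrite /unzip1 map_cat last_cat.
  - apply: side_centered; apply: side_aastar; rewrite xf in xw hv *.
    exact: alternating_path.
  - exact: phi_cword.
  have := IHv [::] _ L0'' Ls'' _ LP''; rewrite !big_cat !big_seq1 /=.
  rewrite centered_prod_cons {3}/centered_prod big_nil mulr1 !mulrA; apply.
  - by rewrite /unzip1 map_cat last_cat.
  - by rewrite -lw.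
  - by move=> j; rewrite height_nil.
  - move=> j; have := hp j.+1; rewrite hg height_nil !add0r /=.
    by rewrite -[x :: w ++ _]cat_cons height_cat hv add0r.
  - move: h; rewrite flatten_cat height_cat hg add0r /=.
    by rewrite -[x :: w ++ _]cat_cons height_cat hv add0r.
  - by move: sN; rewrite flatten_cat size_cat /= size_cat; clear; lia.
(* Otherwise the factor starts below level 0 or goes down first. The path stays nonpositive
   throughout it, and the factor joins the run. *)
have gE : (g ++ (x :: w) :: vs) = rcons g (x :: w) ++ vs by rewrite cat_rcons.
have := IHv (rcons g (x :: w)) L L0 Ls Ll LP.
rewrite -gE => /(_ ch) IHv'.
have := IHv'; rewrite -cats1 centered_prod_cat !centered_prod_cons.
rewrite {2}/centered_prod big_nil mulr1 !mulrA; apply => //.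
- rewrite flatten_cat; apply: nonpositive_cat => // j; rewrite /= cats0.
  have := height_take_alternating j xw; have := hp 0%N; move: gx.
  rewrite take0 height_nil addr0; case: (x) => /=; rewrite ?andbF ?andbT; clear; lia.
- move=> j; have := hp j.+1; rewrite flatten_cat /= cats0.
  by rewrite -[x :: w ++ _]cat_cons !height_cat addrA.
Qed.

Let breaks_nonpositive ws := forall j, height (flatten (take j ws)) <= 0.

Let phi_rot ws1 ws2 : phi (cprod (ws1 ++ ws2)) = phi (cprod (ws2 ++ ws1)).
Proof. by rewrite !centered_prod_cat phi_tr. Qed.

(** Starting from a highest breakpoint with the letter [a], the first factor must return to level 0
    and is a centered power of [a * star a]. It forms the initial list for [free_run], and the
    remaining factors are short enough for the induction hypothesis. *)
Let start_at_peak ws : chain false ws -> ws != [::] -> breaks_nonpositive ws ->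
  height (flatten ws) = 0 -> (size (flatten ws) <= N)%N -> phi (cprod ws) = 0.
Proof.
case: ws => [//|[//|x w] vs] /= /and3P[/eqP-> xw chv] _ br.
rewrite -[false :: w ++ _]cat_cons height_cat => h sN.
have hv : height (false :: w) = 0.
  have := br 1%N; rewrite /= take0 cats0 height_alternating //.
  by case: (last false w).
have lw : last false w = true.
  by move: hv; rewrite height_alternating //; case: (last false w).
have := @free_run vs [::] [:: (false, cword (false :: w))].
rewrite big_seq1 /= centered_prod_cons {1}/centered_prod big_nil mulr1; apply=> //.
- move=> p; rewrite inE => /eqP-> /=; split; last exact: phi_cword.
  by apply: side_centered; apply: side_aastar; apply: alternating_path.
- by rewrite -lw.
- by move=> j; rewrite height_nil.
- move=> j; have := br j.+1.
  by rewrite /= -[false :: w ++ _]cat_cons height_cat hv height_nil !add0r.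
- by move: h; rewrite hv add0r.
- by move: sN; rewrite size_cat /=; clear; lia.
Qed.

(** If the chain begins with [star a], its last factor ends with [star a]. This factor climbs from a
    level at most 0 to level 0, so it begins with [a] and has height 0; rotating it to the front
    gives a chain that begins with [a]. *)
Let cyclic_chain_breaks b ws : chain b ws -> last b (flatten ws) = b -> ws != [::] ->
  breaks_nonpositive ws -> height (flatten ws) = 0 -> (size (flatten ws) <= N)%N ->
  phi (cprod ws) = 0.
Proof.
case: b; last by move=> ch _ ws0 br h sN; apply: start_at_peak.
case/lastP: ws => // ws v; rewrite -cats1 chain_cat flatten_cat last_cat /= cats0.
case: v => [|x w]; first by rewrite andbF.
rewrite andbT => /andP[ch /andP[/eqP xl xw]] lw _ br; rewrite height_cat => h sN.
have hw0 : height (flatten ws) <= 0 by have := br (size ws); rewrite take_size_cat.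
have {xl} xf : x = false.
  case: x xl xw lw h {br sN} => // _ xw /= lw; rewrite height_alternating // lw eqxx /exponent.
  by move: hw0; clear; lia.
rewrite {}xf /= in xw lw h sN br *.
have hv : height (false :: w) = 0 by rewrite height_alternating // lw.
rewrite phi_rot /=; apply: start_at_peak => //=.
- by rewrite xw lw.
- case=> [|j]; first by rewrite take0 height_nil.
  rewrite /= -[false :: w ++ _]cat_cons height_cat hv add0r.
  case: (leqP j (size ws)) => jw.
    by have := br j; rewrite takel_cat.
  by rewrite take_oversize // ltnW.
- by rewrite -[false :: w ++ _]cat_cons height_cat addrC.
- by move: sN; rewrite !size_cat /=; clear; lia.
Qed.

(** The condition on the last letter closes the chain cyclically, so all its rotations are chains,
    and traciality permits starting at a highest breakpoint. *)
Let cyclic_chain b ws : chain b ws -> last b (flatten ws) = b -> ws != [::] ->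
  height (flatten ws) = 0 -> (size (flatten ws) <= N)%N -> phi (cprod ws) = 0.
Proof.
move=> ch lb ws0 h sN; have [r br] := rot_nonpositive h.
rewrite -(cat_take_drop r ws) phi_rot.
move: ch lb; rewrite -{1 2}(cat_take_drop r ws) chain_cat flatten_cat last_cat.
move=> /andP[ch1 ch2] lb.
apply: (cyclic_chain_breaks (b := last b (flatten (take r ws)))) => //.
- by rewrite chain_cat ch2 lb.
- by rewrite flatten_cat last_cat lb.
- by rewrite -size_eq0 size_cat addnC -size_cat cat_take_drop size_eq0.
- by rewrite flatten_cat height_cat addrC -height_cat -flatten_cat cat_take_drop.
- by rewrite flatten_cat size_cat addnC -size_cat -flatten_cat cat_take_drop.
Qed.

Lemma phi_chain_step b ws : chain b ws -> ws != [::] -> (size (flatten ws) <= N)%N ->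
  phi (cprod ws) = 0.
Proof.
move=> ch ws0 sN; have [h|h] := eqVneq (height (flatten ws)) 0; last first.
  by rewrite phi_centered_prod centered_height //= cats0.
have [lb|lb] := eqVneq (last b (flatten ws)) b; first exact: cyclic_chain lb ws0 h sN.
case: ws ch ws0 h sN lb => // v1 ws; case/lastP: ws => [|ws vn] ch _ h sN lb.
  by rewrite centered_prod_cons /centered_prod big_nil mulr1 phi_cword.
case: v1 ch h sN lb => // x v; rewrite -cats1 => /= /and3P[/eqP-> {x} bv].
rewrite chain_cat /= !flatten_cat !last_cat /= !cats0.
case: vn => [|y u]; first by rewrite andbF.
rewrite andbT => /andP[chw /andP[/eqP yl yu]] h sN lb.
have bvE : b :: v ++ flatten ws ++ y :: u = (b :: v) ++ (flatten ws ++ y :: u) by [].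
have yubv : path differ y (u ++ b :: v).
  by rewrite cat_path yu /= bv andbT /differ; exact: lb.
have hE : height ((y :: u) ++ b :: v) + height (flatten ws) = 0.
  by rewrite -[RHS]h bvE !height_cat -addrA addrC addrA.
have szE : (size (flatten ws) + size v + size u + 2 <= N)%N.
  by move: sN; rewrite /= !size_cat /=; clear; lia.
(* With just two factors, the merged word would begin and end with the same letter, so its height
   could not be 0. *)
have [ws_nil|wsn] := eqVneq ws [::].
  move: hE yl; rewrite ws_nil /= height_nil addr0 height_alternating // last_cat /=.
  by move=> + yl; rewrite -yl eqxx; case: (y).
rewrite centered_prod_cons centered_prod_cat mulrA phi_tr mulrA.
rewrite centered_prod_cons {1}/centered_prod big_nil mulr1.
(* The last and the first factor merge cyclically into one alternating word. *)
have -> : cword (y :: u) * cword (b :: v) =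
    cword ((y :: u) ++ b :: v) + (mu ((y :: u) ++ b :: v))%:A
    - mu (b :: v) *: cword (y :: u) - mu (y :: u) *: cword (b :: v)
    - (mu (b :: v) * mu (y :: u))%:A.
  rewrite /centered_word subrK word_cat mulrBl !mulrBr !mulr_algl mulr_algr.
  rewrite !scalerBr !scalerA [mu (y :: u) * _]mulrC !opprB.
  rewrite [RHS]addrAC; congr (_ + _).
  by rewrite -[RHS]addrA [X in _ = _ + X]addrAC subrr add0r.
have cw : phi (cprod ws) = 0 by apply: IH chw wsn; move: szE; clear; lia.
have c1 : phi (cword (y :: u) * cprod ws) = 0.
  rewrite phi_tr; have -> : cprod ws * cword (y :: u) = cprod (ws ++ [:: y :: u]).
    by rewrite centered_prod_cat /centered_prod big_seq1.
  apply: (IH (b := last b v)); rewrite ?flatten_cat ?size_cat /= ?cats0 ?size_cat.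
  - by move: szE; rewrite /=; clear; lia.
  - by rewrite chain_cat chw /= -yl eqxx yu.
  - by case: (ws).
have c2 : phi (cword (b :: v) * cprod ws) = 0.
  rewrite -centered_prod_cons (IH (b := b)) //=.
    by move: szE; rewrite size_cat; clear; lia.
  by rewrite eqxx bv.
move: (cword (y :: u)) (cword (b :: v)) c1 c2 => Y V c1 c2.
rewrite !mulrBl mulrDl !linearB linearD /= -!scalerAl !mul1r !linearZ /=.
rewrite cw c1 c2 !mulr0 !subr0 addr0 -centered_prod_cons.
(* All other terms contain shorter chains. The merged factor begins with [y], the last letter of
   [ws], so the chain is now closed, with its total length unchanged. *)
apply: (cyclic_chain (b := y)) => //=.
- by rewrite eqxx yubv last_cat.
- by rewrite !last_cat /= -yl.
- by rewrite -[y :: _ ++ _]cat_cons height_cat -hE.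
- by move: szE; rewrite !size_cat /=; clear; lia.
Qed.

End Step.

Lemma free_Rdiag : RdiagMoments mu.
Proof.
split=> // [|b ws ch ws0]; first by rewrite /word_moment word_nil.
rewrite -phi_centered_prod; have [n] := ubnP (size (flatten ws)).
elim: n b ws ch ws0 => // n IHn b ws ch ws0; rewrite ltnS => sn.
by apply: (@phi_chain_step n _ b) => // c vs vsn cvs vs0; apply: (IHn c).
Qed.

End Converse.

Theorem theorem9 (R : realType) (A : starAlgType R[i]) (phi : {scalar A})
    (Hphi : scalar_probability_space phi) (a : A) :
  R_diagonal phi a <->
  (forall z : R[i], `|z| = 1 -> same_distribution phi a (z *: a)) /\
  free_pair phi [set a * star a] (K_alg a).
Proof.
have [[phi1 _] _ phi_tr _] := Hphi.
rewrite Rdiag_moments // same_distribution_scale; split=> [mu_diag|[mu0 a_free]].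
  by split; [case: mu_diag|apply: Rdiag_free].
exact: free_Rdiag.
Qed.
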